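(* Let $n\ge2$ and let $\rho_d$ be a generic density operator on $\mathbb{C}^n$. Then $J(\rho)=\mathrm{Tr}(\rho\rho_d)$ is a Morse function on $\mathcal{M}$. It has exactly $n!$ critical points, all hyperbolic; two of them correspond to the global maximum (value $J_{\max}$) and the global minimum (value $J_{\min}$) of $J$, respectively, and the other $n!-2$ critical points are saddles, with critical values $J_0$ satisfying $J_{\min}<J_0<J_{\max}$.
   Context: A density operator is a positive semidefinite Hermitian $n\times n$ matrix of trace $1$; it is generic if it has $n$ distinct eigenvalues. $\mathcal{M}$ is the compact manifold of density operators with the same spectrum as $\rho_d$ (of dimension $n^2-n$). A critical point is hyperbolic if the Hessian of the function at that point is nondegenerate; a Morse function is one all of whose critical points are hyperbolic. A saddle is a critical point whose Hessian has both positive and negative eigenvalues. *)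

(* Defs.v *)
From HB Require Import structures.
From mathcomp Require Import all_boot all_order all_algebra.
From mathcomp Require Import all_classical all_reals all_analysis.
From mathcomp Require Import complex.

Set Implicit Arguments.
Unset Strict Implicit.
Unset Printing Implicit Defensive.

Import Order.TTheory GRing.Theory Num.Theory.
Import numFieldNormedType.Exports.

Local Open Scope classical_set_scope.
Local Open Scope ring_scope.
Local Open Scope sesquilinear_scope.

Section DensityOperators.
Context {R : realType} {n : nat}.
Implicit Types rho : 'M[R[i]]_n.

(* On R[i], [0 <= z] says that z is real and nonnegative. *)
Definition positive_semidefinite rho : Prop :=
  forall v : 'cV[R[i]]_n, 0 <= (v ^t* *m rho *m v) 0 0.

Definition density_operator rho : Prop :=
  [/\ rho \is hermsymmx, positive_semidefinite rho & \tr rho = 1].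

Definition generic rho : Prop :=
  exists lambda : 'I_n -> R[i],
    injective lambda /\ forall k, eigenvalue rho (lambda k).

(* Equality of the characteristic polynomials: same eigenvalues, with the
   same multiplicities. *)
Definition same_spectrum rho rho' : Prop := char_poly rho = char_poly rho'.

Definition isospectral_manifold (rho_d : 'M[R[i]]_n) : set 'M[R[i]]_n :=
  [set rho | density_operator rho /\ same_spectrum rho rho_d].

(* The trace is real when both matrices are Hermitian, so that taking the
   real part only changes its type. *)
Definition overlap (rho_d rho : 'M[R[i]]_n) : R :=
  complex.Re (\tr (rho *m rho_d)).

End DensityOperators.

Section Calculus.
Context {R : realType} {m : nat}.

Definition partial {E : normedModType R} (j : 'I_m) (f : 'rV[R]_m -> E) :
    'rV[R]_m -> E :=
  fun x => 'D_(delta_mx 0 j) f x.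

Fixpoint Ck_on {E : normedModType R} (k : nat) (U : set 'rV[R]_m)
    (f : 'rV[R]_m -> E) : Prop :=
  (forall x, U x -> {for x, continuous f}) /\
  (if k is k'.+1 then
     forall j, (forall x, U x -> derivable f x (delta_mx 0 j)) /\
               Ck_on k' U (partial j f)
   else True).

Definition smooth_on {E : normedModType R} (U : set 'rV[R]_m)
    (f : 'rV[R]_m -> E) : Prop :=
  forall k, Ck_on k U f.

Definition hessian (f : 'rV[R]_m -> R) (x : 'rV[R]_m) : 'M[R]_m :=
  \matrix_(i, j) partial i (partial j f) x.

End Calculus.

Section Submanifolds.
Context {R : realType} {n : nat}.

(* The identification of the space of complex matrices with a real normed
   space, through which it gets its topology and its smooth structure. *)
Definition reim (A : 'M[R[i]]_n) : 'M[R]_n * 'M[R]_n :=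
  (map_mx (@complex.Re R) A, map_mx (@complex.Im R) A).

(* phi, restricted to some open neighbourhood U of 0, is a smooth immersion and
   a homeomorphism onto an open subset of M, with phi 0 = p. Given injectivity
   and continuity, the last condition is that phi maps open subsets of U to
   relatively open subsets of M; it contains phi @` U `<=` M. *)
Definition local_parametrization (M : set 'M[R[i]]_n) (m : nat)
    (p : 'M[R[i]]_n) (phi : 'rV[R]_m -> 'M[R[i]]_n) : Prop :=
  exists U : set 'rV[R]_m,
    [/\ open U /\ U 0,
        phi 0 = p,
        smooth_on U (reim \o phi),
        (forall x v, U x -> v != 0 -> 'D_v (reim \o phi) x != 0) &
        set_inj U phi /\
        forall V : set 'rV[R]_m, open V -> V `<=` U ->
          exists2 W : set ('M[R]_n * 'M[R]_n),
            open W & phi @` V = M `&` reim @^-1` W].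

(* P holds in the local parametrizations of the m-dimensional submanifold M
   at p: there is one, and P holds in all of them. *)
Definition in_local_coordinates (M : set 'M[R[i]]_n) (m : nat)
    (p : 'M[R[i]]_n) (P : ('rV[R]_m -> 'M[R[i]]_n) -> Prop) : Prop :=
  (exists phi : 'rV[R]_m -> 'M[R[i]]_n, local_parametrization M p phi) /\
  (forall phi, local_parametrization M p phi -> P phi).

Section Functions.
Context (M : set 'M[R[i]]_n) (m : nat) (f : 'M[R[i]]_n -> R).
Implicit Types p : 'M[R[i]]_n.

Definition critical_point p : Prop :=
  @in_local_coordinates M m p
    (fun phi => forall j, partial j (f \o phi) 0 = 0).

Definition hyperbolic p : Prop :=
  critical_point p /\
  @in_local_coordinates M m p (fun phi => hessian (f \o phi) 0 \in unitmx).

Definition saddle p : Prop :=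
  critical_point p /\
  @in_local_coordinates M m p (fun phi =>
    (exists2 a, 0 < a & eigenvalue (hessian (f \o phi) 0) a) /\
    (exists2 b, b < 0 & eigenvalue (hessian (f \o phi) 0) b)).

Definition smooth_function : Prop :=
  forall p, M p -> @in_local_coordinates M m p (fun phi =>
    exists U : set 'rV[R]_m, [/\ open U, U 0 & smooth_on U (f \o phi)]).

Definition Morse_function : Prop :=
  smooth_function /\ forall p, critical_point p -> hyperbolic p.

End Functions.

End Submanifolds.

(* Main.v *)
Require Import Defs.
From HB Require Import structures.
From mathcomp Require Import all_boot all_order all_fingroup all_algebra.
From mathcomp Require Import all_classical all_reals all_analysis.
From mathcomp Require Import complex.
From mathcomp Require Import spectral sesquilinear.
From mathcomp Require Import ring lra zify.

(* Write rho_d = Z0 diag(d) Z0^* with d increasing.  Along a chart phi of M, the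
   traces tr(phi^k) are constant, so tr(g(phi) d_j phi) = 0 for every polynomial
   g: in an eigenbasis of p, the tangent vectors at p are Hermitian matrices with
   zero diagonal, and by dimension count all of them.  Hence p is critical iff
   rho_d is diagonal in an eigenbasis of p, i.e. p = Z0 diag(d o s) Z0^* for a
   permutation s.  Differentiating tr(g(phi) d_j phi) = 0 once more, with
   g(p) = rho_d, shows that the Hessian at this point is the quadratic form
     X |-> - sum_(a <> b) (d_a - d_b) / (d_(s a) - d_(s b)) |X_ab|^2,
   which is nondegenerate, and indefinite unless s is the identity or the order
   reversal.  The identity is the global maximum because tr((rho - rho_d)^2) >= 0;
   the reversal is the global minimum by a dual certificate of the assignment
   problem, applied to a bistochastic matrix |V_ab|^2.

   Charts come from flags: a point of M is determined by its spectral projections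
   P_k on the span of the first k eigenvectors, and near a given point this flag
   is spanned by the columns of a unique lower unitriangular matrix L, whose
   subdiagonal entries are n^2 - n real coordinates.  The P_k are rational in L.
   Conversely P_k is a polynomial in rho, and the column a of L is A^-1 e_a, where
   A = (1 - T)(1 - P_(a+1)) + T P_(a+1) and T keeps the first a + 1 coordinates. *)

Set Implicit Arguments.
Unset Strict Implicit.
Unset Printing Implicit Defensive.

Import Order.TTheory GRing.Theory Num.Theory.
Import numFieldNormedType.Exports.

Local Open Scope classical_set_scope.
Local Open Scope card_scope.
Local Open Scope ring_scope.

(** * Smooth maps on R^m *)

(** The notions [critical_point], [hyperbolic] and [saddle] quantify over all local parametrizations
    and also require that one exist. The two demands are met separately. The gradient and the
    Hessian of [J] are computed in an arbitrary chart, from the constant traces, hermiticity and the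
    immersion condition, so no change of charts ever occurs. The flag chart only supplies existence.
    There the obstacle is openness, which needs a continuous inverse on an open set of matrices.
    Eigenvectors are determined only up to a phase, whereas spectral projections have no such
    ambiguity; Kato's operator then recovers a normalized frame from them by rational formulas. The
    coefficients of the Hessian are divided differences of a polynomial g with g(p) = rho_d. An
    inversion of s makes one of them negative, a pair kept in order makes one positive, and only the
    reversal or the identity lacks one of the two kinds. Strictness of the extreme values is a
    matter of permutations, not of the Hessian: a transposition lowers the value at any s other than
    the reversal. *)

Section LinearDerivative.
Context {R : realType} {V E E' : normedModType R}.

Lemma is_derive_linear (L : E -> E') (f : V -> E) x v d :
  linear L -> continuous L -> is_derive x v f d -> is_derive x v (L \o f) (L d).
Proof.
move=> lL cL [df fd].
have L0 : L 0 = 0 by have := lL (-1) 0 0; rewrite scaleN1r oppr0 addr0 scaleN1r addNr.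
have LZ (a : R) u : L (a *: u) = a *: L u by rewrite -[a *: u]addr0 lL L0 addr0.
have LB u w : L (u - w) = L u - L w.
  by rewrite addrC -scaleN1r lL scaleN1r addrC.
have key : (fun h : R => h^-1 *: ((L \o f) (h *: v + x) - (L \o f) x)) @ 0^'
   --> L d.
  have -> : (fun h : R => h^-1 *: ((L \o f) (h *: v + x) - (L \o f) x)) =
    L \o (fun h : R => h^-1 *: (f (h *: v + x) - f x)).
    by apply/funext => h; rewrite /= LZ LB.
  apply: cvg_comp; last exact: (cL d).
  by rewrite -fd; exact: df.
split; first by apply/cvg_ex; exists (L d); exact: key.
exact: (cvg_lim (@norm_hausdorff _ _) key).
Qed.

End LinearDerivative.

Section SmoothCalculus.
Context {R : realType} {m : nat}.
Implicit Types (U : set 'rV[R]_m) (k : nat).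

Lemma near_open_eq (T : topologicalType) (E : Type) (U : set T) (f g : T -> E) x :
  open U -> U x -> (forall y, U y -> f y = g y) -> {near x, f =1 g}.
Proof.
move=> oU Ux fg; apply: filterS (open_nbhs_nbhs (conj oU Ux)) => y Uy.
by rewrite /= fg.
Qed.

Lemma is_derive_open_eq {V E : normedModType R} (U : set V) (f g : V -> E) x v d :
  open U -> U x -> (forall y, U y -> f y = g y) ->
  is_derive x v f d -> is_derive x v g d.
Proof.
move=> oU Ux fg fd.
exact: (near_eq_is_derive (near_open_eq oU Ux fg)).
Qed.

Lemma continuous_open_eq {V E : topologicalType} (U : set V) (f g : V -> E) x :
  open U -> U x -> (forall y, U y -> f y = g y) ->
  {for x, continuous f} -> {for x, continuous g}.
Proof.
move=> oU Ux fg; rewrite /prop_for /continuous_at -(fg _ Ux) => cf.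
apply: cvg_trans cf; apply: near_eq_cvg.
exact: near_open_eq oU Ux fg.
Qed.

Section Ck.
Context {E : normedModType R}.
Implicit Types f g : 'rV[R]_m -> E.

Lemma Ck_on_ext k U f g : open U -> (forall x, U x -> f x = g x) ->
  Ck_on k U f -> Ck_on k U g.
Proof.
move=> oU; elim: k f g => [|k IH] f g fg /= [cf df].
  split=> // x Ux; exact: continuous_open_eq oU Ux fg (cf x Ux).
split; first by move=> x Ux; exact: continuous_open_eq oU Ux fg (cf x Ux).
move=> j; have [dj Cj] := df j.
have gd x : U x -> is_derive x (delta_mx 0 j) g (partial j f x).
  move=> Ux; apply: (is_derive_open_eq oU Ux fg).
  exact: derivableP (dj x Ux).
split; first by move=> x Ux; case: (gd x Ux).
by apply: IH Cj => x Ux; case: (gd x Ux).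
Qed.

Lemma Ck_on_pred k U f : Ck_on k.+1 U f -> Ck_on k U f.
Proof.
elim: k f => [|k IH] f /= [cf df]; first by [].
by split=> // j; have [? ?] := df j; split=> //; apply: IH.
Qed.

(** The closure lemmas below use this to replace [partial j f] by an explicit product or quotient
    rule that holds on [U] only: [U] is open, so agreement on it is agreement near each of its
    points. *)
Lemma Ck_on_S k U f (df : 'I_m -> 'rV[R]_m -> E) : open U ->
  (forall x, U x -> {for x, continuous f}) ->
  (forall j x, U x -> is_derive x (delta_mx 0 j) f (df j x)) ->
  (forall j, Ck_on k U (df j)) -> Ck_on k.+1 U f.
Proof.
move=> oU cf fd Cd; split=> // j; split; first by move=> x /(fd j) [].
by apply: Ck_on_ext oU _ (Cd j) => x /(fd j) [].
Qed.

Lemma Ck_on_continuous k U f : Ck_on k U f -> forall x, U x -> {for x, continuous f}.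
Proof. by case: k => [|k] /= []. Qed.

Lemma Ck_on_is_derive k U f j x : Ck_on k.+1 U f -> U x ->
  is_derive x (delta_mx 0 j) f (partial j f x).
Proof. by move=> /= [_ /(_ j) [df _]] Ux; apply: derivableP; exact: df. Qed.

Lemma Ck_on_partial k U f j : Ck_on k.+1 U f -> Ck_on k U (partial j f).
Proof. by move=> /= [_ /(_ j) []]. Qed.

Lemma Ck_on_cst k U (c : E) : open U -> Ck_on k U (fun=> c).
Proof.
move=> oU; elim: k c => [|k IH] c.
  by split=> // x _; exact: cst_continuous.
apply: (@Ck_on_S _ _ _ (fun _ _ => 0)) => //.
- by move=> x _; exact: cst_continuous.
Qed.

Lemma Ck_on_add k U f g : open U -> Ck_on k U f -> Ck_on k U g ->
  Ck_on k U (fun x => f x + g x).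
Proof.
move=> oU; elim: k f g => [|k IH] f g Cf Cg.
  split=> // x Ux; apply: continuousD;
    [exact: (Ck_on_continuous Cf)|exact: (Ck_on_continuous Cg)].
apply: (@Ck_on_S _ _ _ (fun j x => partial j f x + partial j g x)) => //.
- move=> x Ux; apply: continuousD;
    [exact: (Ck_on_continuous Cf)|exact: (Ck_on_continuous Cg)].
- move=> j x Ux; have := is_deriveD; apply;
    [exact: (Ck_on_is_derive j Cf)|exact: (Ck_on_is_derive j Cg)].
- by move=> j; apply: IH; apply: Ck_on_partial.
Qed.

Lemma Ck_on_sum k U (I : Type) (r : seq I) (F : I -> 'rV[R]_m -> E) : open U ->
  (forall i, Ck_on k U (F i)) -> Ck_on k U (fun x => \sum_(i <- r) F i x).
Proof.
move=> oU CF; elim: r => [|i r IH].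
  by apply: Ck_on_ext oU _ (Ck_on_cst k 0 oU) => x _; rewrite big_nil.
by apply: Ck_on_ext oU _ (Ck_on_add oU (CF i) IH) => x _; rewrite big_cons.
Qed.

End Ck.

Lemma Ck_on_linear {E E' : normedModType R} (L : E -> E') k U f :
  linear L -> continuous L -> open U -> Ck_on k U f -> Ck_on k U (L \o f).
Proof.
move=> lL cL oU; have cLf (g : 'rV[R]_m -> E) x :
    {for x, continuous g} -> {for x, continuous (L \o g)}.
  by move=> cg; apply: continuous_comp => //; exact: cL.
elim: k f => [|k IH] f Cf.
  by split=> // x Ux; apply: cLf; exact: (Ck_on_continuous Cf).
apply: (@Ck_on_S _ _ _ _ (fun j => L \o partial j f)) => //.
- by move=> x Ux; apply: cLf; exact: (Ck_on_continuous Cf).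
- by move=> j x Ux; apply: is_derive_linear => //; apply: Ck_on_is_derive Cf Ux.
- by move=> j; apply: IH; apply: Ck_on_partial.
Qed.

Implicit Types f g : 'rV[R]_m -> R.

Lemma Ck_on_mul k U f g : open U -> Ck_on k U f -> Ck_on k U g ->
  Ck_on k U (fun x => f x * g x).
Proof.
move=> oU; have cM (h h' : 'rV[R]_m -> R) x :
    {for x, continuous h} -> {for x, continuous h'} ->
    {for x, continuous (fun x => h x * h' x)}.
  by move=> ch ch'; exact: (cvgM ch ch').
elim: k f g => [|k IH] f g Cf Cg.
  by split=> // x Ux; apply: cM;
    [exact: (Ck_on_continuous Cf)|exact: (Ck_on_continuous Cg)].
apply: (@Ck_on_S _ _ _ _
  (fun j x => f x * partial j g x + g x * partial j f x)) => //.
- by move=> x Ux; apply: cM;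
    [exact: (Ck_on_continuous Cf)|exact: (Ck_on_continuous Cg)].
- move=> j x Ux.
  have df := Ck_on_is_derive j Cf Ux; have dg := Ck_on_is_derive j Cg Ux.
  exact: is_deriveM.
- move=> j; apply: Ck_on_add => //; apply: IH;
    by [exact: Ck_on_pred | exact: Ck_on_partial].
Qed.

Lemma Ck_on_inv k U f : open U -> (forall x, U x -> f x != 0) -> Ck_on k U f ->
  Ck_on k U (fun x => (f x)^-1).
Proof.
move=> oU f0; have cV x : U x -> {for x, continuous f} ->
    {for x, continuous (fun x => (f x)^-1)}.
  by move=> Ux cf; apply: cvgV cf; exact: f0.
elim: k => [|k IH] Cf.
  by split=> // x Ux; apply: cV => //; exact: (Ck_on_continuous Cf).
(* The partial derivative - f^-2 d_j f contains 1/f again, but only with one order of smoothness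
   less, which the induction hypothesis provides. *)
have CV := IH (Ck_on_pred Cf).
apply: (@Ck_on_S _ _ _ _
  (fun j x => (- 1 * ((f x)^-1 * (f x)^-1)) * partial j f x)) => //.
- by move=> x Ux; apply: cV => //; exact: (Ck_on_continuous Cf).
- move=> j x Ux; have [df Df] := Ck_on_is_derive j Cf Ux.
  split; first exact: (derivableV (f0 _ Ux) df).
  rewrite (deriveV (f0 _ Ux) df) Df mulN1r.
  by rewrite -[in RHS]expr2 exprVn.
- move=> j; apply: Ck_on_mul => //; last exact: Ck_on_partial.
  by do 2?apply: Ck_on_mul => //; exact: Ck_on_cst.
Qed.

Lemma Ck_on_coord k U (j : 'I_m) : open U -> Ck_on k U (fun x => x 0 j).
Proof.
move=> oU; have cc x : {for x, continuous (fun x : 'rV[R]_m => x 0 j)}.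
  exact: coord_continuous.
case: k => [|k]; first by split=> // x _; exact: cc.
apply: (@Ck_on_S _ _ _ _ (fun i x => (delta_mx 0 i : 'rV[R]_m) 0 j)) => //.
- move=> i x _.
  apply: (@is_derive_linear R 'rV[R]_m 'rV[R]_m R
    (fun A : 'rV[R]_m => A 0 j) id x (delta_mx 0 i)); [by move=> a A B; rewrite !mxE|exact: coord_continuous].
- by move=> i; exact: Ck_on_cst.
Qed.

Lemma is_derive_scale_dir {V : normedModType R} (f : V -> R) x v d c :
  is_derive x v f d -> is_derive x (c *: v) f (c * d).
Proof.
move=> [df fd]; have [->|c0] := eqVneq c 0.
  by rewrite scale0r mul0r; exact: is_derive0.
have key : (fun h : R => h^-1 *: (f (h *: (c *: v) + x) - f x)) @ 0^' --> c * d.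
  have -> : (fun h : R => h^-1 *: (f (h *: (c *: v) + x) - f x)) =
    (fun h : R => c * (fun h : R => h^-1 *: (f (h *: v + x) - f x)) (h * c)).
    apply/funext => h; rewrite scalerA /GRing.scale /=.
    by rewrite invfM mulrA mulrCA mulfV // mulr1.
  apply: cvgMl_tmp.
  apply: (@cvg_comp _ _ _ (fun h : R => h * c)
    (fun h : R => h^-1 *: (f (h *: v + x) - f x)) _ 0^'); last first.
    by rewrite -fd; exact: df.
  move=> A /= A0.
  have c0' : (fun h : R => h * c) @ (0 : R) --> (0 : R).
    have := @mulrr_continuous _ c 0; rewrite /continuous_at mul0r; exact.
  have := c0' _ A0; rewrite /= !near_simpl => H.
  near=> h; have h0 : h != 0 by near: h; exact: nbhs_dnbhs_neq.
  have : h * c != 0 -> A (h * c) by near: h; exact: nbhs_dnbhs H.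
  by apply; rewrite mulf_neq0.
split; first by apply/cvg_ex; exists (c * d); exact: key.
exact: (cvg_lim (@norm_hausdorff _ _) key).
Unshelve. all: by end_near. Qed.

Lemma derive_line {V : normedModType R} (f : V -> R) (w v : V) (s : R) d :
  is_derive (s *: v + w) v f d -> is_derive s 1 (fun t : R => f (t *: v + w)) d.
Proof.
have E : (fun h : R => h^-1 *: (f ((h *: 1 + s) *: v + w) - f (s *: v + w))) =
   (fun h : R => h^-1 *: (f (h *: v + (s *: v + w)) - f (s *: v + w))).
  by apply/funext => h; rewrite [h%:A]mulr1 scalerDl addrA.
by move=> [df fd]; split; rewrite /derivable /derive E.
Qed.

(* Mean value theorem along [a], started at the moving base point [h *: b + x]. *)
Lemma is_derive_add_dir {V : normedModType R} (f : V -> R) (x a b : V) (db : R) :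
  (\forall y \near x, derivable f y a) ->
  {for x, continuous ('D_a f)} ->
  is_derive x b f db -> is_derive x (a + b) f ('D_a f x + db).
Proof.
move=> da ca [fb Db].
pose G1 (h : R) := h^-1 *: (f (h *: a + (h *: b + x)) - f (h *: b + x)).
pose G2 (h : R) := h^-1 *: (f (h *: b + x) - f x).
have EG : (fun h : R => h^-1 *: (f (h *: (a + b) + x) - f x)) = G1 \+ G2.
  apply/funext => h; rewrite /G1 /G2 /= -scalerDr; congr (_ *: _).
  by rewrite scalerDr addrA subrK addrA.
have key1 : G1 @ 0^' --> 'D_a f x.
  apply/cvgrPdist_le => e e0.
  have near_x : \forall y \near x, derivable f y a /\ `|'D_a f x - 'D_a f y| <= e.
    by near=> y; split; near: y => //; move/cvgrPdist_le: ca; exact.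
  have [r /= r0 rx] := (nbhs_ballP _ _).1 near_x.
  (* Points [c *: a + (h *: b + x)] with |c| <= |h| are within |h| K of [x]. The summand 1 keeps [K]
     positive when [a] and [b] both vanish. *)
  pose K := `|a| + `|b| + 1.
  have K0 : 0 < K by rewrite ltr_wpDl // addr_ge0.
  have small (h c : R) : `|h| < r / K -> `|c| <= `|h| ->
      derivable f (c *: a + (h *: b + x)) a /\
      `|'D_a f x - 'D_a f (c *: a + (h *: b + x))| <= e.
    move=> hr ch; apply: rx; rewrite -ball_normE /=.
    rewrite distrC addrA addrK.
    apply: (le_lt_trans (ler_normD _ _)); rewrite !normrZ.
    apply: (@le_lt_trans _ _ (`|h| * K)).
      rewrite /K mulrDr mulr1 mulrDr -[leLHS]addr0 lerD // lerD //.
      by rewrite ler_wpM2r.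
    by rewrite -ltr_pdivlMr.
  near=> h.
  have h0 : h != 0 by near: h; exact: nbhs_dnbhs_neq.
  have hr : `|h| < r / K by near: h; apply: dnbhs0_lt; rewrite divr_gt0.
  pose phi (t : R) := f (t *: a + (h *: b + x)).
  have dphi (c : R) : `|c| <= `|h| ->
      is_derive c 1 phi ('D_a f (c *: a + (h *: b + x))).
    by move=> /(small _ _ hr) [dd _]; apply: derive_line; exact: derivableP.
  have cphi (u v : R) : (forall c, c \in `[u, v] -> `|c| <= `|h|) ->
     {within `[u, v], continuous phi}.
    move=> uv; apply: derivable_within_continuous => c /uv /dphi.
    by case.
  have [c ch Ec] : exists2 c, `|c| <= `|h| &
     phi h - phi 0 = 'D_a f (c *: a + (h *: b + x)) * h.
    have [hp|hn] := leP 0 h.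
      have B c : c \in `[0, h] -> `|c| <= `|h|.
        by rewrite in_itv /= => /andP[c0 ch]; rewrite !ger0_norm.
      have [|c cI] := @MVT_segment R phi
        (fun c => 'D_a f (c *: a + (h *: b + x))) 0 h hp _ (cphi _ _ B).
        by move=> c cI; apply: dphi; apply: B; exact: subset_itv_oo_cc.
      by rewrite subr0 => Ec; exists c => //; exact: B.
    have B c : c \in `[h, 0] -> `|c| <= `|h|.
      rewrite in_itv /= => /andP[hc c0].
      by rewrite !ler0_norm ?lerN2 // ltW.
    have [|c cI] := @MVT_segment R phi
      (fun c => 'D_a f (c *: a + (h *: b + x))) h 0 (ltW hn) _ (cphi _ _ B).
      by move=> c cI; apply: dphi; apply: B; exact: subset_itv_oo_cc.
    rewrite sub0r mulrN => Ec; exists c; first exact: B.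
    by rewrite -[LHS]opprB Ec opprK.
  have -> : G1 h = 'D_a f (c *: a + (h *: b + x)).
    rewrite /G1 -/(phi h); have -> : f (h *: b + x) = phi 0.
      by rewrite /phi scale0r add0r.
    by rewrite Ec [_ *: _]mulrC mulfK.
  by have [] := small _ _ hr ch.
have key2 : G2 @ 0^' --> db by rewrite -Db; exact: fb.
have key : (G1 \+ G2) @ 0^' --> 'D_a f x + db by exact: cvgD key1 key2.
split; first by apply/cvg_ex; exists ('D_a f x + db); rewrite EG; exact: key.
by rewrite /derive EG; exact: (cvg_lim (@norm_hausdorff _ _) key).
Unshelve. all: by end_near. Qed.

(** [Ck_on] speaks of coordinate directions only, while the immersion condition involves every
    direction. The coordinates of [v] are added one at a time; continuity of the partial derivatives
    is what makes each addition legitimate. *)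
Lemma C1_is_derive U f x v : open U -> U x -> Ck_on 1 U f ->
  is_derive x v f (\sum_j v 0 j * partial j f x).
Proof.
move=> oU Ux C1; rewrite {1}(row_sum_delta v).
elim/big_rec2: _ => [|j d w _ IH]; first exact: is_derive0.
have dj y : U y -> is_derive y (v 0 j *: delta_mx 0 j) f (v 0 j * partial j f y).
  by move=> Uy; apply: is_derive_scale_dir; exact: Ck_on_is_derive C1 Uy.
have -> : v 0 j * partial j f x = 'D_(v 0 j *: delta_mx 0 j) f x.
  by have [_ ->] := dj _ Ux.
apply: is_derive_add_dir IH.
  by apply: filterS (open_nbhs_nbhs (conj oU Ux)) => y /dj [].
apply: (continuous_open_eq (f := fun y => v 0 j * partial j f y) oU Ux).
  by move=> y /dj [_ ->].
have cp : {for x, continuous (partial j f)}.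
  exact: (Ck_on_continuous (Ck_on_partial j C1) Ux).
have cv : {for x, continuous (fun _ : 'rV[R]_m => v 0 j)}.
  exact: cst_continuous.
exact: (cvgM cv cp).
Qed.

End SmoothCalculus.

(** * Functions with values in complex matrices *)

Fact adjoint_key : unit. Proof. by []. Qed.
(* Locked, because unification unfolds the conjugation of [R[i]] eagerly. *)
Definition adjoint {R : realType} {p q : nat} : 'M[R[i]]_(p, q) -> 'M[R[i]]_(q, p) :=
  locked_with adjoint_key (fun A => map_mx Num.conj A^T).

Local Notation "M ^t*" := (adjoint M) (at level 30) : ring_scope.

Lemma adjointE {R : realType} {p q} (A : 'M[R[i]]_(p, q)) : A^t* = map_mx Num.conj A^T.
Proof. by rewrite /adjoint unlock. Qed.

Lemma adjE {R : realType} {p q} (A : 'M[R[i]]_(p, q)) i j : A^t* i j = Num.conj (A j i).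
Proof. by rewrite adjointE !mxE. Qed.

Section ComplexParts.
Context {R : realType}.
Local Notation C := R[i].
Local Notation Re := (@complex.Re R).
Local Notation Im := (@complex.Im R).

Lemma cReD (a b : C) : Re (a + b) = Re a + Re b. Proof. by case: a b => ? ? []. Qed.
Lemma cImD (a b : C) : Im (a + b) = Im a + Im b. Proof. by case: a b => ? ? []. Qed.
Lemma cReN (a : C) : Re (- a) = - Re a. Proof. by case: a. Qed.
Lemma cReM (a b : C) : Re (a * b) = Re a * Re b - Im a * Im b.
Proof. by case: a b => ? ? []. Qed.
Lemma cImM (a b : C) : Im (a * b) = Re a * Im b + Im a * Re b.
Proof. by case: a b => ? ? [? ?] /=; rewrite [in X in _ + X]mulrC. Qed.
Lemma cRe_conj (a : C) : Re (Num.conj a) = Re a. Proof. by case: a. Qed.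
Lemma cIm_conj (a : C) : Im (Num.conj a) = - Im a. Proof. by case: a. Qed.
Lemma Re_sum (I : Type) (r : seq I) (P : pred I) (F : I -> C) :
  Re (\sum_(i <- r | P i) F i) = \sum_(i <- r | P i) Re (F i).
Proof. by elim/big_rec2: _ => // i a b _ <-; rewrite cReD. Qed.
Lemma Im_sum (I : Type) (r : seq I) (P : pred I) (F : I -> C) :
  Im (\sum_(i <- r | P i) F i) = \sum_(i <- r | P i) Im (F i).
Proof. by elim/big_rec2: _ => // i a b _ <-; rewrite cImD. Qed.
Lemma cReV (a : C) : Re a^-1 = Re a / (Re a * Re a + Im a * Im a).
Proof. by case: a => x y; rewrite -!expr2. Qed.
Lemma cImV (a : C) : Im a^-1 = - (Im a / (Re a * Re a + Im a * Im a)).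
Proof. by case: a => x y; rewrite -!expr2. Qed.
Lemma complex_eqP (a b : C) : Re a = Re b -> Im a = Im b -> a = b.
Proof. by case: a b => ? ? [? ?] /= -> ->. Qed.
Lemma normsq_neq0 (a : C) : a != 0 -> Re a * Re a + Im a * Im a != 0.
Proof.
apply: contra_neq => E; have /eqP := E; rewrite paddr_eq0 -?expr2 ?sqr_ge0 //.
by rewrite !sqrf_eq0 => /andP[/eqP ? /eqP ?]; exact: complex_eqP.
Qed.

End ComplexParts.

(** * Closure of complex matrix functions under algebraic operations *)

Section FunctionAlgebra.
Context {R : realType} {T : Type} (D : set T) (S : (T -> R) -> Prop).
Local Notation C := R[i].
Local Notation Re := (@complex.Re R).
Local Notation Im := (@complex.Im R).

(* The closure arguments below serve both for continuity and for smoothness. *)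
Record fun_algebra : Prop := FunAlgebra {
  fa_ext : forall f g, (forall x, D x -> f x = g x) -> S f -> S g;
  fa_cst : forall c, S (fun=> c);
  fa_add : forall f g, S f -> S g -> S (fun x => f x + g x);
  fa_mul : forall f g, S f -> S g -> S (fun x => f x * g x);
  fa_inv : forall f, (forall x, D x -> f x != 0) -> S f -> S (fun x => (f x)^-1) }.

Definition cplx_in (f : T -> C) : Prop :=
  S (fun x => Re (f x)) /\ S (fun x => Im (f x)).
Definition mx_in {p q} (F : T -> 'M[C]_(p, q)) : Prop :=
  forall i j, cplx_in (fun x => F x i j).

Hypothesis alg : fun_algebra.

Lemma fa_opp f : S f -> S (fun x => - f x).
Proof.
move=> Sf; apply: (fa_ext alg _ (fa_mul alg (fa_cst alg (-1)) Sf)) => x _.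
by rewrite mulN1r.
Qed.

Lemma cplx_in_ext f g : (forall x, D x -> f x = g x) -> cplx_in f -> cplx_in g.
Proof. by move=> fg [Sr Si]; split; [apply: fa_ext Sr | apply: fa_ext Si] => // x /fg ->. Qed.

Lemma cplx_in_cst c : cplx_in (fun=> c).
Proof. by split; exact: fa_cst. Qed.

Lemma cplx_in_add f g : cplx_in f -> cplx_in g -> cplx_in (fun x => f x + g x).
Proof.
move=> [fr fi] [gr gi]; split.
- by apply: (fa_ext alg _ (fa_add alg fr gr)) => x _; rewrite cReD.
- by apply: (fa_ext alg _ (fa_add alg fi gi)) => x _; rewrite cImD.
Qed.

Lemma cplx_in_mul f g : cplx_in f -> cplx_in g -> cplx_in (fun x => f x * g x).
Proof.
move=> [fr fi] [gr gi]; split.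
- apply: (fa_ext alg _ (fa_add alg (fa_mul alg fr gr) (fa_opp (fa_mul alg fi gi)))).
  by move=> x _; rewrite cReM.
- apply: (fa_ext alg _ (fa_add alg (fa_mul alg fr gi) (fa_mul alg fi gr))).
  by move=> x _; rewrite cImM.
Qed.

Lemma cplx_in_conj f : cplx_in f -> cplx_in (fun x => Num.conj (f x)).
Proof.
move=> [fr fi]; split.
- by apply: (fa_ext alg _ fr) => x _; rewrite cRe_conj.
- by apply: (fa_ext alg _ (fa_opp fi)) => x _; rewrite cIm_conj.
Qed.

Lemma cplx_in_inv f : (forall x, D x -> f x != 0) -> cplx_in f ->
  cplx_in (fun x => (f x)^-1).
Proof.
move=> f0 [fr fi].
have Sn := fa_inv alg (fun x Dx => normsq_neq0 (f0 x Dx))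
  (fa_add alg (fa_mul alg fr fr) (fa_mul alg fi fi)).
split.
- by apply: (fa_ext alg _ (fa_mul alg fr Sn)) => x _; rewrite cReV.
- by apply: (fa_ext alg _ (fa_opp (fa_mul alg fi Sn))) => x _; rewrite cImV.
Qed.

Lemma cplx_in_sum (I : Type) (r : seq I) (F : I -> T -> C) :
  (forall i, cplx_in (F i)) -> cplx_in (fun x => \sum_(i <- r) F i x).
Proof.
move=> SF; elim: r => [|i r IH].
  by apply: cplx_in_ext (cplx_in_cst 0) => x _; rewrite big_nil.
by apply: cplx_in_ext (cplx_in_add (SF i) IH) => x _; rewrite big_cons.
Qed.

Lemma cplx_in_prod (I : Type) (r : seq I) (F : I -> T -> C) :
  (forall i, cplx_in (F i)) -> cplx_in (fun x => \prod_(i <- r) F i x).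
Proof.
move=> SF; elim: r => [|i r IH].
  by apply: cplx_in_ext (cplx_in_cst 1) => x _; rewrite big_nil.
by apply: cplx_in_ext (cplx_in_mul (SF i) IH) => x _; rewrite big_cons.
Qed.

Section Matrices.
Context {p q : nat}.
Implicit Types F G : T -> 'M[C]_(p, q).

Lemma mx_in_ext F G : (forall x, D x -> F x = G x) -> mx_in F -> mx_in G.
Proof. by move=> FG SF i j; apply: cplx_in_ext (SF i j) => x /FG ->. Qed.

Lemma mx_in_cst (A : 'M[C]_(p, q)) : mx_in (fun=> A).
Proof. by move=> i j; exact: cplx_in_cst. Qed.

Lemma mx_in_add F G : mx_in F -> mx_in G -> mx_in (fun x => F x + G x).
Proof.
move=> SF SG i j; apply: cplx_in_ext (cplx_in_add (SF i j) (SG i j)) => x _.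
by rewrite mxE.
Qed.

Lemma mx_in_scale f F : cplx_in f -> mx_in F -> mx_in (fun x => f x *: F x).
Proof.
move=> Sf SF i j; apply: cplx_in_ext (cplx_in_mul Sf (SF i j)) => x _.
by rewrite mxE.
Qed.

Lemma mx_in_opp F : mx_in F -> mx_in (fun x => - F x).
Proof.
move=> SF; apply: mx_in_ext (mx_in_scale (cplx_in_cst (-1)) SF) => x _.
by rewrite scaleN1r.
Qed.

Lemma mx_in_sub F G : mx_in F -> mx_in G -> mx_in (fun x => F x - G x).
Proof. by move=> SF SG; apply: mx_in_add => //; exact: mx_in_opp. Qed.

Lemma mx_in_sum (I : Type) (r : seq I) (F : I -> T -> 'M[C]_(p, q)) :
  (forall i, mx_in (F i)) -> mx_in (fun x => \sum_(i <- r) F i x).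
Proof.
move=> SF i j; apply: cplx_in_ext (cplx_in_sum r (fun k => SF k i j)) => x _.
by rewrite summxE.
Qed.

Lemma mx_in_adj F : mx_in F -> mx_in (fun x => (F x)^t*).
Proof.
move=> SF i j; apply: cplx_in_ext (cplx_in_conj (SF j i)) => x _.
by rewrite adjE.
Qed.

End Matrices.

Lemma mx_in_mul {p q r} (F : T -> 'M[C]_(p, q)) (G : T -> 'M[C]_(q, r)) :
  mx_in F -> mx_in G -> mx_in (fun x => F x *m G x).
Proof.
move=> SF SG i j.
apply: cplx_in_ext (cplx_in_sum (index_enum _)
  (fun k => cplx_in_mul (SF i k) (SG k j))) => x _.
by rewrite mxE.
Qed.

Lemma cplx_in_det {p} (F : T -> 'M[C]_p) : mx_in F -> cplx_in (fun x => \det (F x)).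
Proof.
move=> SF; apply: cplx_in_sum => s; apply: cplx_in_mul; first exact: cplx_in_cst.
exact: cplx_in_prod.
Qed.

(** Cramer's rule: the adjugate is polynomial in the entries of [F], and the determinant does not
    vanish on [D]. *)
Lemma mx_in_inv {p} (F : T -> 'M[C]_p) : (forall x, D x -> F x \in unitmx) ->
  mx_in F -> mx_in (fun x => invmx (F x)).
Proof.
move=> uF SF.
have Sd : cplx_in (fun x => (\det (F x))^-1).
  by apply: cplx_in_inv (cplx_in_det SF) => x /uF; rewrite unitmxE unitfE.
have Sa : mx_in (fun x => \adj (F x)).
  move=> i j; apply: (@cplx_in_ext
    (fun x => (-1) ^+ (j + i) * \det (row' j (col' i (F x))))).
    by move=> x _; rewrite !mxE.
  apply: cplx_in_mul; first exact: cplx_in_cst.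
  apply: cplx_in_det => k l; apply: cplx_in_ext (SF (lift j k) (lift i l)) => x _.
  by rewrite !mxE.
by apply: mx_in_ext (mx_in_scale Sd Sa) => x Dx; rewrite /invmx uF.
Qed.

Lemma mx_in_horner {p} (F : T -> 'M[C]_p.+1) (g : {poly C}) :
  mx_in F -> mx_in (fun x => horner_mx (F x) g).
Proof.
move=> SF; elim/poly_ind: g => [|g c IH].
  by apply: mx_in_ext (mx_in_cst 0) => x _; rewrite rmorph0.
apply: mx_in_ext (mx_in_add (mx_in_mul IH SF) (mx_in_cst c%:M)) => x _.
by rewrite rmorphD rmorphM /= horner_mx_X horner_mx_C.
Qed.

End FunctionAlgebra.

Lemma continuous_fun_algebra {R : realType} {T : topologicalType} (D : set T) :
  open D -> fun_algebra D (fun f : T -> R => forall x, D x -> {for x, continuous f}).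
Proof.
move=> oD; split.
- move=> f g fg cf x Dx; exact: (continuous_open_eq oD Dx fg (cf x Dx)).
- by move=> c x _; exact: cst_continuous.
- move=> f g cf cg x Dx; exact: (cvgD (cf x Dx) (cg x Dx)).
- move=> f g cf cg x Dx; exact: (cvgM (cf x Dx) (cg x Dx)).
- move=> f f0 cf x Dx; exact: (cvgV (f0 x Dx) (cf x Dx)).
Qed.

Lemma smooth_fun_algebra {R : realType} {m : nat} (U : set 'rV[R]_m) :
  open U -> fun_algebra U (@smooth_on R m R U).
Proof.
move=> oU; split.
- by move=> f g fg Sf k; exact: (Ck_on_ext oU fg (Sf k)).
- by move=> c k; exact: Ck_on_cst.
- by move=> f g Sf Sg k; exact: Ck_on_add.
- by move=> f g Sf Sg k; exact: Ck_on_mul.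
- by move=> f f0 Sf k; exact: Ck_on_inv.
Qed.

(** * Entrywise derivatives of complex matrix functions *)

Section MatrixDerivative.
Context {R : realType} {V : normedModType R}.
Local Notation C := R[i].
Local Notation Re := (@complex.Re R).
Local Notation Im := (@complex.Im R).
Implicit Types (x v : V).

Definition is_cder (f : V -> C) x v (d : C) : Prop :=
  is_derive x v (fun y => Re (f y)) (Re d) /\
  is_derive x v (fun y => Im (f y)) (Im d).

Definition is_mder {p q} (F : V -> 'M[C]_(p, q)) x v (A : 'M[C]_(p, q)) : Prop :=
  forall i j, is_cder (fun y => F y i j) x v (A i j).

Lemma is_cder_cst c x v : is_cder (fun=> c) x v 0.
Proof. by split; exact: is_derive_cst. Qed.

Lemma is_cder_add f g x v a b : is_cder f x v a -> is_cder g x v b ->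
  is_cder (fun y => f y + g y) x v (a + b).
Proof.
move=> [fr fi] [gr gi]; split.
- have -> : (fun y => Re (f y + g y)) = (fun y => Re (f y)) \+ (fun y => Re (g y)).
    by apply/funext => y; rewrite cReD.
  by rewrite cReD; exact: is_deriveD.
- have -> : (fun y => Im (f y + g y)) = (fun y => Im (f y)) \+ (fun y => Im (g y)).
    by apply/funext => y; rewrite cImD.
  by rewrite cImD; exact: is_deriveD.
Qed.

Lemma is_cder_mul f g x v a b : is_cder f x v a -> is_cder g x v b ->
  is_cder (fun y => f y * g y) x v (a * g x + f x * b).
Proof.
move=> [fr fi] [gr gi]; split.
- have -> : (fun y => Re (f y * g y)) =
     (fun y => Re (f y)) * (fun y => Re (g y)) - (fun y => Im (f y)) * (fun y => Im (g y)).
    by apply/funext => y; rewrite cReM.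
  have h1 := is_deriveM fr gr; have h2 := is_deriveM fi gi.
  apply: (is_derive_eq (is_deriveB h1 h2)).
  by rewrite cReD !cReM /GRing.scale /=; ring.
- have -> : (fun y => Im (f y * g y)) =
     (fun y => Re (f y)) * (fun y => Im (g y)) + (fun y => Im (f y)) * (fun y => Re (g y)).
    by apply/funext => y; rewrite cImM.
  have h1 := is_deriveM fr gi; have h2 := is_deriveM fi gr.
  apply: (is_derive_eq (is_deriveD h1 h2)).
  by rewrite cImD !cImM /GRing.scale /=; ring.
Qed.

Lemma is_cder_conj f x v a : is_cder f x v a ->
  is_cder (fun y => Num.conj (f y)) x v (Num.conj a).
Proof.
move=> [fr fi]; split.
- rewrite cRe_conj; have -> // : (fun y => Re (Num.conj (f y))) = (fun y => Re (f y)).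
  by apply/funext => y; rewrite cRe_conj.
- rewrite cIm_conj; have -> : (fun y => Im (Num.conj (f y))) = - (fun y => Im (f y)).
    by apply/funext => y; rewrite cIm_conj.
  exact: is_deriveN.
Qed.

Lemma is_cder_sum (I : Type) (r : seq I) (F : I -> V -> C) (a : I -> C) x v :
  (forall i, is_cder (F i) x v (a i)) ->
  is_cder (fun y => \sum_(i <- r) F i y) x v (\sum_(i <- r) a i).
Proof.
move=> dF; elim: r => [|i r IH].
  rewrite big_nil; have -> : (fun y => \sum_(i <- [::]) F i y) = fun=> 0.
    by apply/funext => y; rewrite big_nil.
  exact: is_cder_cst.
rewrite big_cons.
have -> : (fun y => \sum_(j <- i :: r) F j y) = fun y => F i y + \sum_(j <- r) F j y.
  by apply/funext => y; rewrite big_cons.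
exact: is_cder_add.
Qed.

Lemma is_cder_uniq f x v a b : is_cder f x v a -> is_cder f x v b -> a = b.
Proof.
by move=> [[_ ra] [_ ia]] [[_ rb] [_ ib]]; apply: complex_eqP;
  rewrite -?ra -?ia -?rb -?ib.
Qed.

Lemma is_cder_open_eq (U : set V) f g x v a : open U -> U x ->
  (forall y, U y -> f y = g y) -> is_cder f x v a -> is_cder g x v a.
Proof.
move=> oU Ux fg [fr fi]; split.
- by apply: (is_derive_open_eq oU Ux _ fr) => y /fg ->.
- by apply: (is_derive_open_eq oU Ux _ fi) => y /fg ->.
Qed.

Section Shape.
Context {p q : nat}.
Implicit Types (F G : V -> 'M[C]_(p, q)) (A B : 'M[C]_(p, q)).

Lemma is_mder_cst A x v : is_mder (fun=> A) x v 0.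
Proof. by move=> i j; rewrite mxE; exact: is_cder_cst. Qed.

Lemma is_mder_add F G x v A B : is_mder F x v A -> is_mder G x v B ->
  is_mder (fun y => F y + G y) x v (A + B).
Proof.
move=> dF dG i j; rewrite mxE.
have -> : (fun y => (F y + G y) i j) = fun y => F y i j + G y i j.
  by apply/funext => y; rewrite mxE.
exact: is_cder_add.
Qed.

Lemma is_mder_uniq F x v A B : is_mder F x v A -> is_mder F x v B -> A = B.
Proof. by move=> FA FB; apply/matrixP => i j; apply: is_cder_uniq (FA i j) (FB i j). Qed.

Lemma is_mder_open_eq (U : set V) F G x v A : open U -> U x ->
  (forall y, U y -> F y = G y) -> is_mder F x v A -> is_mder G x v A.
Proof.
by move=> oU Ux FG dF i j; apply: (is_cder_open_eq oU Ux _ (dF i j)) => y /FG ->.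
Qed.

Lemma is_mder_adj F x v A : is_mder F x v A ->
  is_mder (fun y => (F y)^t*) x v (A^t*).
Proof.
move=> dF i j; rewrite adjE.
have -> : (fun y => (F y)^t* i j) = fun y => Num.conj (F y j i).
  by apply/funext => y; rewrite adjE.
exact: is_cder_conj.
Qed.

End Shape.

Lemma is_mder_mul {p q r} (F : V -> 'M[C]_(p, q)) (G : V -> 'M[C]_(q, r)) x v A B :
  is_mder F x v A -> is_mder G x v B ->
  is_mder (fun y => F y *m G y) x v (A *m G x + F x *m B).
Proof.
move=> dF dG i j.
have -> : (fun y => (F y *m G y) i j) = fun y => \sum_k F y i k * G y k j.
  by apply/funext => y; rewrite mxE.
rewrite !mxE -big_split /=; apply: is_cder_sum => k; exact: is_cder_mul.
Qed.

Lemma is_mder_mull {p q r} (A : 'M[C]_(p, q)) (G : V -> 'M[C]_(q, r)) x v B :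
  is_mder G x v B -> is_mder (fun y => A *m G y) x v (A *m B).
Proof.
by move=> dG; have := is_mder_mul (is_mder_cst A x v) dG; rewrite mul0mx add0r.
Qed.

Lemma is_mder_mulr {p q r} (F : V -> 'M[C]_(p, q)) (B : 'M[C]_(q, r)) x v A :
  is_mder F x v A -> is_mder (fun y => F y *m B) x v (A *m B).
Proof.
by move=> dF; have := is_mder_mul dF (is_mder_cst B x v); rewrite mulmx0 addr0.
Qed.

Lemma is_cder_tr {p} (F : V -> 'M[C]_p) x v A : is_mder F x v A ->
  is_cder (fun y => \tr (F y)) x v (\tr A).
Proof. by move=> dF; apply: is_cder_sum. Qed.

(** Existence suffices: the derivative of g(F) is later determined by differentiating the relation
    g(F) F = F g(F). *)
Lemma is_mder_horner {p} (F : V -> 'M[C]_p.+1) x v A (g : {poly C}) :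
  is_mder F x v A -> exists B, is_mder (fun y => horner_mx (F y) g) x v B.
Proof.
move=> dF; elim/poly_ind: g => [|g c [B dB]].
  exists 0; have -> : (fun y => horner_mx (F y) 0) = fun=> 0.
    by apply/funext => y; rewrite rmorph0.
  exact: is_mder_cst.
exists (B *m F x + horner_mx (F x) g *m A + 0).
have -> : (fun y => horner_mx (F y) (g * 'X + c%:P)) =
   fun y => horner_mx (F y) g *m F y + c%:M.
  by apply/funext => y; rewrite rmorphD rmorphM /= horner_mx_X horner_mx_C.
by apply: is_mder_add; [exact: is_mder_mul | exact: is_mder_cst].
Qed.

(** Serves the immersion property: a direction that does not move a matrix to first order does not
    move its spectral projections either, these being polynomials in it. *)
Lemma is_mder_horner0 {p} (F : V -> 'M[C]_p.+1) x v (g : {poly C}) :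
  is_mder F x v 0 -> is_mder (fun y => horner_mx (F y) g) x v 0.
Proof.
move=> dF; elim/poly_ind: g => [|g c dB].
  have -> : (fun y => horner_mx (F y) 0) = fun=> 0.
    by apply/funext => y; rewrite rmorph0.
  exact: is_mder_cst.
have -> : (fun y => horner_mx (F y) (g * 'X + c%:P)) =
   fun y => horner_mx (F y) g *m F y + c%:M.
  by apply/funext => y; rewrite rmorphD rmorphM /= horner_mx_X horner_mx_C.
have := is_mder_add (is_mder_mul dB dF) (is_mder_cst c%:M x v).
by rewrite mul0mx mulmx0 !addr0.
Qed.

End MatrixDerivative.

Section RealAndImaginaryParts.
Context {R : realType} {n : nat}.
Local Notation C := R[i].
Local Notation Re := (@complex.Re R).
Local Notation Im := (@complex.Im R).
Local Notation E := ('M[R]_n * 'M[R]_n)%type.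

Definition unreim (P : E) : 'M[C]_n := \matrix_(i, j) Complex (P.1 i j) (P.2 i j).

Lemma reimK : cancel (@reim R n) unreim.
Proof. by move=> A; apply/matrixP => i j; rewrite !mxE /=; case: (A i j). Qed.

Lemma continuous_fst_coord (i j : 'I_n) : continuous (fun P : E => P.1 i j).
Proof.
move=> P; apply: (@continuous_comp _ _ _ fst (fun A : 'M[R]_n => A i j)).
  exact: cvg_fst.
exact: coord_continuous.
Qed.

Lemma continuous_snd_coord (i j : 'I_n) : continuous (fun P : E => P.2 i j).
Proof.
move=> P; apply: (@continuous_comp _ _ _ snd (fun A : 'M[R]_n => A i j)).
  exact: cvg_snd.
exact: coord_continuous.
Qed.

Lemma linear_fst_coord (i j : 'I_n) : linear (fun P : E => P.1 i j).
Proof. by move=> a P Q; rewrite !mxE. Qed.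

Lemma linear_snd_coord (i j : 'I_n) : linear (fun P : E => P.2 i j).
Proof. by move=> a P Q; rewrite !mxE. Qed.

Lemma unreim_continuous (D : set E) :
  mx_in (fun f : E -> R => forall P, D P -> {for P, continuous f}) unreim.
Proof.
move=> i j; split=> P _.
- have -> : (fun P => Re (unreim P i j)) = (fun P => P.1 i j).
    by apply/funext => Q; rewrite mxE.
  exact: continuous_fst_coord.
- have -> : (fun P => Im (unreim P i j)) = (fun P => P.2 i j).
    by apply/funext => Q; rewrite mxE.
  exact: continuous_snd_coord.
Qed.

Definition re_unit (i j : 'I_n) (r : R) : E := r *: (delta_mx i j, 0).
Definition im_unit (i j : 'I_n) (r : R) : E := r *: (0, delta_mx i j).

(** Writes [reim] as a sum of continuous linear maps [r |-> r *: c] applied to the real and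
    imaginary parts of the entries, so that smoothness and derivatives of [reim \o phi] reduce to
    scalar functions. *)
Lemma reim_sum (A : 'M[C]_n) :
  reim A = \sum_i \sum_j (re_unit i j (Re (A i j)) + im_unit i j (Im (A i j))).
Proof.
under eq_bigr do rewrite big_split /=.
rewrite big_split /=; set X := \sum_i _; set Y := (X in _ + X).
have [X1 X2] : X.1 = map_mx Re A /\ X.2 = 0.
  have E1 (P Q : E) : (P + Q).1 = P.1 + Q.1 by [].
  have E2 (P Q : E) : (P + Q).2 = P.2 + Q.2 by [].
  have s1 (I : Type) (r : seq I) (F : I -> E) :
      (\sum_(i <- r) F i).1 = \sum_(i <- r) (F i).1.
    by apply: (big_morph fst).
  have s2 (I : Type) (r : seq I) (F : I -> E) :
      (\sum_(i <- r) F i).2 = \sum_(i <- r) (F i).2.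
    by apply: (big_morph snd).
  split; last first.
    rewrite /X s2 big1 // => i _; rewrite s2 big1 // => j _.
    by rewrite /re_unit /= scaler0.
  rewrite [RHS]matrix_sum_delta /X s1; apply: eq_bigr => i _.
  by rewrite s1; apply: eq_bigr => j _; rewrite mxE.
have [Y1 Y2] : Y.1 = 0 /\ Y.2 = map_mx Im A.
  have s1 (I : Type) (r : seq I) (F : I -> E) :
      (\sum_(i <- r) F i).1 = \sum_(i <- r) (F i).1.
    by apply: (big_morph fst).
  have s2 (I : Type) (r : seq I) (F : I -> E) :
      (\sum_(i <- r) F i).2 = \sum_(i <- r) (F i).2.
    by apply: (big_morph snd).
  split.
    rewrite /Y s1 big1 // => i _; rewrite s1 big1 // => j _.
    by rewrite /im_unit /= scaler0.
  rewrite [RHS]matrix_sum_delta /Y s2; apply: eq_bigr => i _.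
  by rewrite s2; apply: eq_bigr => j _; rewrite mxE.
case: X X1 X2 => [X1' X2'] /= -> ->; case: Y Y1 Y2 => [Y1' Y2'] /= -> ->.
by rewrite /reim; congr pair; rewrite ?addr0 ?add0r.
Qed.

Lemma scale_continuous (F : normedModType R) (c : F) : continuous (fun r : R => r *: c).
Proof. by move=> r; apply: cvgZr_tmp; exact: cvg_id. Qed.

Lemma scale_linear (F : normedModType R) (c : F) : linear (fun r : R => r *: c).
Proof. by move=> a u v; rewrite scalerDl -scalerA. Qed.

Section Smooth.
Context {m : nat}.
Implicit Types (U : set 'rV[R]_m) (phi : 'rV[R]_m -> 'M[C]_n).

Lemma smooth_reimP U phi : open U ->
  smooth_on U (@reim R n \o phi) <-> mx_in (@smooth_on R m R U) phi.
Proof.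
move=> oU; split=> Sphi.
  move=> i j; split=> k.
  - have -> : (fun x => Re (phi x i j)) =
       (fun P : E => P.1 i j) \o (@reim R n \o phi).
      by apply/funext => x /=; rewrite mxE.
    apply: Ck_on_linear => //; first exact: linear_fst_coord.
    exact: continuous_fst_coord.
  - have -> : (fun x => Im (phi x i j)) =
       (fun P : E => P.2 i j) \o (@reim R n \o phi).
      by apply/funext => x /=; rewrite mxE.
    apply: Ck_on_linear => //; first exact: linear_snd_coord.
    exact: continuous_snd_coord.
move=> k; apply: (@Ck_on_ext _ _ _ _ _ (fun x => \sum_i \sum_j
  (re_unit i j (Re (phi x i j)) + im_unit i j (Im (phi x i j))))) => //.
  by move=> x _; rewrite /= reim_sum.
apply: Ck_on_sum => // i; apply: Ck_on_sum => // j; have [Sr Si] := Sphi i j.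
apply: Ck_on_add => //.
- apply: (Ck_on_linear (L := re_unit i j) _ _ oU (Sr k)).
    exact: scale_linear.
  exact: scale_continuous.
- apply: (Ck_on_linear (L := im_unit i j) _ _ oU (Si k)).
    exact: scale_linear.
  exact: scale_continuous.
Qed.

Lemma is_derive_seq_sum {V F : normedModType R} (I : Type) (r : seq I)
    (f : I -> V -> F) (d : I -> F) x v :
  (forall i, is_derive x v (f i) (d i)) ->
  is_derive x v (fun y => \sum_(i <- r) f i y) (\sum_(i <- r) d i).
Proof.
move=> df; elim: r => [|i r IH].
  rewrite big_nil; have -> : (fun y => \sum_(i <- [::]) f i y) = fun=> 0.
    by apply/funext => y; rewrite big_nil.
  exact: is_derive_cst.
rewrite big_cons.
have -> : (fun y => \sum_(j <- i :: r) f j y) = f i \+ fun y => \sum_(j <- r) f j y.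
  by apply/funext => y; rewrite big_cons.
exact: is_deriveD.
Qed.

Lemma is_mder_reim {V : normedModType R} (phi : V -> 'M[C]_n) x v A :
  is_mder phi x v A -> is_derive x v (@reim R n \o phi) (reim A).
Proof.
move=> dphi; have -> : @reim R n \o phi = fun x => \sum_i \sum_j
  (re_unit i j (Re (phi x i j)) + im_unit i j (Im (phi x i j))).
  by apply/funext => y /=; rewrite reim_sum.
rewrite reim_sum; apply: is_derive_seq_sum => i; apply: is_derive_seq_sum => j.
have [dr di] := dphi i j; apply: is_deriveD.
- apply: (is_derive_linear (L := re_unit i j) _ _ dr).
    exact: scale_linear.
  exact: scale_continuous.
- apply: (is_derive_linear (L := im_unit i j) _ _ di).
    exact: scale_linear.
  exact: scale_continuous.
Qed.

Lemma reim0 : reim (0 : 'M[C]_n) = 0.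
Proof. by congr pair; apply/matrixP => i j; rewrite !mxE. Qed.

Lemma reim_inj : injective (@reim R n).
Proof. exact: can_inj reimK. Qed.

End Smooth.
End RealAndImaginaryParts.

Section MatrixPartials.
Context {R : realType} {m p q : nat}.
Local Notation C := R[i].
Local Notation Re := (@complex.Re R).
Local Notation Im := (@complex.Im R).
Implicit Types (U : set 'rV[R]_m) (phi : 'rV[R]_m -> 'M[C]_(p, q)).

Definition mpartial (j : 'I_m) phi (x : 'rV[R]_m) : 'M[C]_(p, q) :=
  \matrix_(a, b) Complex (partial j (fun y => Re (phi y a b)) x)
                         (partial j (fun y => Im (phi y a b)) x).

Lemma mpartial_is_mder U phi j x : mx_in (@smooth_on R m R U) phi -> U x ->
  is_mder phi x (delta_mx 0 j) (mpartial j phi x).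
Proof.
move=> Sphi Ux a b; rewrite mxE /=; have [Sr Si] := Sphi a b.
by split; [exact: Ck_on_is_derive (Sr 1%N) Ux | exact: Ck_on_is_derive (Si 1%N) Ux].
Qed.

Lemma mpartial_smooth U phi j : mx_in (@smooth_on R m R U) phi ->
  mx_in (@smooth_on R m R U) (mpartial j phi).
Proof.
move=> Sphi a b; have [Sr Si] := Sphi a b; split=> k.
- have -> : (fun x => Re (mpartial j phi x a b)) = partial j (fun y => Re (phi y a b)).
    by apply/funext => x; rewrite mxE.
  exact: Ck_on_partial (Sr k.+1).
- have -> : (fun x => Im (mpartial j phi x a b)) = partial j (fun y => Im (phi y a b)).
    by apply/funext => x; rewrite mxE.
  exact: Ck_on_partial (Si k.+1).
Qed.

Lemma smooth_is_mder U phi x v : open U -> mx_in (@smooth_on R m R U) phi -> U x ->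
  is_mder phi x v (\sum_j (v 0 j)%:C%C *: mpartial j phi x).
Proof.
move=> oU Sphi Ux a b; have [Sr Si] := Sphi a b; rewrite summxE; split.
- rewrite Re_sum; apply: (is_derive_eq (C1_is_derive v oU Ux (Sr 1%N))).
  by apply: eq_bigr => j _; rewrite !mxE cReM /= mul0r subr0.
- rewrite Im_sum; apply: (is_derive_eq (C1_is_derive v oU Ux (Si 1%N))).
  by apply: eq_bigr => j _; rewrite !mxE cImM /= mul0r addr0.
Qed.

End MatrixPartials.

Lemma open_cplx_neq0 {R : realType} {T : topologicalType} (D : set T) (f : T -> R[i]) :
  open D ->
  cplx_in (fun g : T -> R => forall x, D x -> {for x, continuous g}) f ->
  open (D `&` [set x | f x != 0]).
Proof.
move=> oD [cr ci].
pose g x : R := complex.Re (f x) * complex.Re (f x) + complex.Im (f x) * complex.Im (f x).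
have cg x : D x -> {for x, continuous g}.
  move=> Dx; apply: cvgD; apply: cvgM; by [exact: (cr x Dx) | exact: (ci x Dx)].
have fg x : (f x != 0) = (g x != 0).
  apply/idP/idP; first exact: normsq_neq0.
  by apply: contra_neq => fx; rewrite /g fx /= mulr0 addr0.
rewrite openE => x [Dx /= fx]; rewrite /interior.
apply: filterI; first exact: open_nbhs_nbhs.
have : nbhs (g x) [set r : R | r != 0].
  apply: open_nbhs_nbhs; split; first exact: open_neq.
  by rewrite /= -fg.
move/(cg x Dx) => H; have {}H : nbhs x [set y | g y != 0] by exact: H.
by apply: filterS H => y /=; rewrite fg.
Qed.

Lemma smooth_continuous {R : realType} {m : nat} (U : set 'rV[R]_m) (f : 'rV[R]_m -> R[i]) :
  cplx_in (@smooth_on R m R U) f ->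
  cplx_in (fun g : 'rV[R]_m -> R => forall x, U x -> {for x, continuous g}) f.
Proof. by move=> [Sr Si]; split; [exact: (Sr 0%N).1 | exact: (Si 0%N).1]. Qed.

(** * Isospectral density operators *)

Section Adjoint.
Context {R : realType}.
Local Notation C := R[i].

Lemma adjmxM {p q r} (A : 'M[C]_(p, q)) (B : 'M[C]_(q, r)) :
  (A *m B)^t* = B^t* *m A^t*.
Proof. by rewrite !adjointE trmx_mul map_mxM. Qed.

Lemma adjmxD {p q} (A B : 'M[C]_(p, q)) : (A + B)^t* = A^t* + B^t*.
Proof. by rewrite !adjointE linearD /= map_mxD. Qed.

Lemma adjmxB {p q} (A B : 'M[C]_(p, q)) : (A - B)^t* = A^t* - B^t*.
Proof. by rewrite !adjointE linearB /= map_mxB. Qed.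

Lemma adjmx1 {p} : (1%:M : 'M[C]_p)^t* = 1%:M.
Proof. by rewrite !adjointE trmx1 map_mx1. Qed.

Lemma adjmx0 {p q} : (0 : 'M[C]_(p, q))^t* = 0.
Proof. by rewrite !adjointE trmx0 map_mx0. Qed.

Lemma adjmxK {p q} (A : 'M[C]_(p, q)) : A^t*^t* = A.
Proof. by apply/matrixP => i j; rewrite !adjE conjCK. Qed.

Lemma herm_adjmxP {p} (A : 'M[C]_p) : reflect (A^t* = A) (A \is hermsymmx).
Proof.
by rewrite adjointE; apply: (iffP (is_hermitianmxP _ _ _)); rewrite expr0 scale1r => /esym.
Qed.

Lemma tr_adjmx_eq0 {p q} (A : 'M[C]_(p, q)) : \tr (A^t* *m A) = 0 -> A = 0.
Proof.
have E : \tr (A^t* *m A) = \sum_i \sum_j `|A j i| ^+ 2.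
  rewrite /mxtrace; apply: eq_bigr => i _; rewrite mxE; apply: eq_bigr => j _.
  by rewrite adjE mulrC -normCK.
have g0 i : 0 <= \sum_j `|A j i| ^+ 2 by rewrite sumr_ge0 // => j _; rewrite exprn_ge0.
move=> /eqP; rewrite E psumr_eq0 // => /allP H; apply/matrixP => j i.
have /implyP/(_ isT) := H i (mem_index_enum _).
rewrite psumr_eq0 => [/allP/(_ j (mem_index_enum _))/=|k _]; last by rewrite exprn_ge0.
by rewrite sqrf_eq0 normr_eq0 mxE => /eqP.
Qed.

Definition real_diag {p} (d : 'I_p -> R) : 'M[C]_p := diag_mx (\row_a (d a)%:C%C).

Definition spec_mx {p} (Z : 'M[C]_p) (d : 'I_p -> R) : 'M[C]_p :=
  Z *m real_diag d *m Z^t*.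

Lemma real_diagE {p} (d : 'I_p -> R) a b : real_diag d a b = (d a)%:C%C *+ (a == b).
Proof. by rewrite !mxE. Qed.

Lemma conj_real (x : R) : Num.conj (x%:C%C) = x%:C%C.
Proof. by apply: complex_eqP; rewrite ?cRe_conj ?cIm_conj //= oppr0. Qed.

Lemma real_diag_adj {p} (d : 'I_p -> R) : (real_diag d)^t* = real_diag d.
Proof.
apply/matrixP => a b; rewrite adjE !real_diagE eq_sym; case: eqP => [->|_].
  by rewrite !mulr1n conj_real.
by rewrite !mulr0n rmorph0.
Qed.

Lemma spec_mx_adj {p} (Z : 'M[C]_p) d : (spec_mx Z d)^t* = spec_mx Z d.
Proof. by rewrite /spec_mx !adjmxM real_diag_adj adjmxK mulmxA. Qed.

Lemma spec_mxE {p} (Z : 'M[C]_p) d i j :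
  spec_mx Z d i j = \sum_a Z i a * (d a)%:C%C * Num.conj (Z j a).
Proof.
rewrite mxE; apply: eq_bigr => a _; rewrite adjE !mxE (bigD1 a) //= big1 => [|b ba].
  by rewrite !mxE eqxx mulr1n addr0.
by rewrite !mxE (negPf ba) mulr0n mulr0.
Qed.

Lemma char_poly_conj {F : comNzRingType} {p} (P Q A : 'M[F]_p) :
  P *m Q = 1%:M -> char_poly (P *m A *m Q) = char_poly A.
Proof.
move=> PQ; rewrite /char_poly.
have PQ' : map_mx polyC P *m map_mx polyC Q = 1%:M by rewrite -map_mxM PQ map_mx1.
have -> : char_poly_mx (P *m A *m Q) =
   map_mx polyC P *m char_poly_mx A *m map_mx polyC Q.
  rewrite /char_poly_mx mulmxBr mulmxBl !map_mxM.
  by rewrite mul_mx_scalar -scalemxAl PQ' scalemx1.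
by rewrite !det_mulmx mulrAC -det_mulmx PQ' det1 mul1r.
Qed.

Lemma char_poly_real_diag {p} (d : 'I_p -> R) :
  char_poly (real_diag d) = \prod_a ('X - ((d a)%:C%C)%:P).
Proof.
rewrite char_poly_trig; last exact: diag_mx_is_trig.
by apply: eq_bigr => a _; rewrite real_diagE eqxx.
Qed.

Lemma char_poly_spec {p} (Z : 'M[C]_p) d : Z *m Z^t* = 1%:M ->
  char_poly (spec_mx Z d) = \prod_a ('X - ((d a)%:C%C)%:P).
Proof. by move=> UZ; rewrite char_poly_conj // char_poly_real_diag. Qed.

Lemma spectral_decomposition {p} (A : 'M[C]_p) : A^t* = A ->
  exists Z d, Z *m Z^t* = 1%:M /\ A = spec_mx Z d.
Proof.
move=> /herm_adjmxP hA.
have US := spectral_unitarymx A.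
have /hermitian_normalmx/orthomx_spectralP EA := hA.
have /mxOverP rl := hermitian_spectral_diag_real hA.
exists ((spectralmx A)^t*), (fun a => complex.Re (spectral_diag A 0 a)); split.
  by rewrite adjmxK adjointE; apply/mulmx1C/unitarymxP.
rewrite {1}EA (invmx_unitary US) -adjointE /spec_mx adjmxK; congr (_ *m diag_mx _ *m _).
by apply/rowP => a; rewrite !mxE RRe_real // rl.
Qed.

Lemma spec_mx_perm {p} (Z : 'M[C]_p) d (s : 'S_p) : Z *m Z^t* = 1%:M ->
  exists Z', Z' *m Z'^t* = 1%:M /\ spec_mx Z d = spec_mx Z' (d \o s).
Proof.
move=> /matrixP UZ; exists (col_perm s Z); split.
  apply/matrixP => i j; rewrite -UZ !mxE [RHS](reindex_inj (@perm_inj _ s)).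
  by apply: eq_bigr => a _; rewrite !adjE !mxE.
apply/matrixP => i j; rewrite !spec_mxE [LHS](reindex_inj (@perm_inj _ s)).
by apply: eq_bigr => a _; rewrite !mxE.
Qed.

Lemma perm_of_perm_eq {T : eqType} {p} (f g : 'I_p -> T) :
  perm_eq [seq f i | i <- enum 'I_p] [seq g i | i <- enum 'I_p] ->
  exists s : 'S_p, f =1 g \o s.
Proof.
move=> fg.
have /tuple_permP [s Es] : perm_eq [tuple f i | i < p] [tuple g i | i < p] by [].
exists s => i; have := congr1 (fun t => nth (f i) t i) Es.
rewrite -[X in nth _ X _]/(val [tuple f i | i < p]) -!tnth_nth.
by rewrite !tnth_mktuple.
Qed.

Lemma prod_XsubC_perm {p} (f g : 'I_p -> C) :
  \prod_a ('X - (f a)%:P) = \prod_a ('X - (g a)%:P) ->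
  exists s : 'S_p, f =1 g \o s.
Proof.
move=> E; apply: perm_of_perm_eq; apply: prod_XsubC_eq.
have H (h : 'I_p -> C) : \prod_(x <- [seq h i | i <- enum 'I_p]) ('X - x%:P) =
    \prod_a ('X - (h a)%:P) by rewrite big_map big_enum.
by rewrite !H.
Qed.

Lemma sorting_perm {p} (d : 'I_p -> R) :
  exists s : 'S_p, forall i j : 'I_p, (i <= j)%N -> d (s i) <= d (s j).
Proof.
pose t := sort <=%O [seq d i | i <- enum 'I_p].
have st : size t = p by rewrite size_sort size_map size_enum_ord.
pose f (i : 'I_p) := nth 0 t i.
have [s Es] : exists s : 'S_p, f =1 d \o s.
  apply: perm_of_perm_eq.
  have -> : [seq f i | i <- enum 'I_p] = t.
    apply: (@eq_from_nth _ 0); rewrite size_map size_enum_ord // => k kp.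
    by rewrite (nth_map (Ordinal kp)) ?size_enum_ord // /f nth_enum_ord.
  by rewrite perm_sort.
exists s => i j ij; have := Es i; have := Es j => /= <- <-.
apply: (sorted_leq_nth le_trans le_refl) => //.
- exact: (sort_sorted le_total).
- by rewrite inE st.
- by rewrite inE st.
Qed.

End Adjoint.

Section IsospectralManifold.
Context {R : realType} {n : nat}.
Local Notation C := R[i].

(** Each of the n distinct eigenvalues is some [d a]. Choosing such an index for each gives an
    injection of a finite set into itself, hence a bijection, along which injectivity passes to
    [d]. *)
Lemma generic_spec_inj (Z : 'M[C]_n) d : Z *m Z^t* = 1%:M -> generic (spec_mx Z d) ->
  injective d.
Proof.
move=> UZ [lam [lami lame]].
have /choice [f fE] k : exists a, lam k = (d a)%:C%C.
  have := lame k; rewrite eigenvalue_root_char char_poly_spec // /root horner_prod.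
  case/prodf_eq0 => a _; rewrite hornerXsubC subr_eq0 => /eqP E; by exists a.
have finj : injective f by move=> k l E; apply: lami; rewrite !fE E.
have [g gK Kg] := injF_bij finj.
move=> a b dab; rewrite -(Kg a) -(Kg b); congr f; apply: lami.
by rewrite !fE !Kg dab.
Qed.

Lemma density_spec (rho_d : 'M[C]_n) : density_operator rho_d -> generic rho_d ->
  exists Z d, [/\ Z *m Z^t* = 1%:M, rho_d = spec_mx Z d,
    (forall i j : 'I_n, (i < j)%N -> d i < d j), (forall i, 0 <= d i) &
    \sum_i d i = 1].
Proof.
move=> [/herm_adjmxP hH hP ht] hg.
have [Z1 [d1 [UZ1 E1]]] := spectral_decomposition hH.
have [s ds] := sorting_perm d1.
have [Z [UZ E]] := spec_mx_perm d1 s UZ1.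
rewrite E in E1; exists Z, (d1 \o s); rewrite E1 in hg hP ht *.
have dinj := generic_spec_inj UZ hg.
have UZ' := mulmx1C UZ.
split=> //.
- move=> i j ij; rewrite lt_neqAle ds ?(ltnW ij) // andbT.
  by apply/eqP => /dinj ji; rewrite ji ltnn in ij.
(* The test vector is the a-th eigenvector, on which the quadratic form takes the value [d a]. *)
- move=> a; have := hP (col a Z); rewrite -adjointE.
  have -> : col a Z = Z *m delta_mx a 0 by rewrite colE.
  rewrite adjmxM -!mulmxA (mulmxA (Z^t*)) UZ' mul1mx (mulmxA (Z^t*)) UZ' mul1mx.
  rewrite mxE (bigD1 a) //= big1 => [|b ba]; last first.
    by rewrite adjE !mxE (negPf ba) /= rmorph0 mul0r.
  rewrite adjE !mxE eqxx rmorph1 mul1r addr0 (bigD1 a) //= big1 => [|b ba]; last first.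
    by rewrite [delta_mx _ _ _ _]mxE (negPf ba) mulr0.
  by rewrite !mxE !eqxx mulr1 addr0 mulr1n /= lecR.
- move: ht; rewrite /spec_mx mxtrace_mulC mulmxA UZ' mul1mx /mxtrace.
  under eq_bigr do rewrite real_diagE eqxx mulr1n.
  by rewrite -rmorph_sum => /complexI.
Qed.

Variables (rho_d Z0 : 'M[C]_n) (d : 'I_n -> R).
Hypothesis UZ0 : Z0 *m Z0^t* = 1%:M.
Hypothesis rho_dE : rho_d = spec_mx Z0 d.
Hypothesis d_ge0 : forall i, 0 <= d i.
Hypothesis d_sum : \sum_i d i = 1.

Lemma spec_isospectral Z (s : 'S_n) : Z *m Z^t* = 1%:M ->
  isospectral_manifold rho_d (spec_mx Z (d \o s)).
Proof.
move=> UZ; have UZ' := mulmx1C UZ; split; last first.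
  rewrite /same_spectrum rho_dE (char_poly_spec _ UZ) (char_poly_spec _ UZ0).
  by rewrite [RHS](reindex_inj (@perm_inj _ s)).
split; first by apply/herm_adjmxP; exact: spec_mx_adj.
- move=> v; pose w := Z^t* *m v.
  rewrite -adjointE; have -> : v^t* *m spec_mx Z (d \o s) *m v = w^t* *m real_diag (d \o s) *m w.
    by rewrite /spec_mx /w adjmxM adjmxK !mulmxA.
  move: w => w.
  rewrite mxE sumr_ge0 // => a _; rewrite mxE (bigD1 a) //= big1 => [|b ba].
    rewrite addr0 real_diagE eqxx mulr1n mulrAC; apply: mulr_ge0.
      by rewrite adjE mulrC mul_conjC_ge0.
    by rewrite lecR; exact: d_ge0.
  by rewrite real_diagE (negPf ba) mulr0n mulr0.
- rewrite /spec_mx mxtrace_mulC mulmxA UZ' mul1mx /mxtrace.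
  under eq_bigr do rewrite real_diagE eqxx mulr1n.
  rewrite -rmorph_sum /= -(rmorph1 (real_complex R)); congr (_%:C)%C.
  by rewrite -d_sum [RHS](reindex_inj (@perm_inj _ s)).
Qed.

(** Together with [spec_isospectral], this puts in M every Hermitian matrix with the characteristic
    polynomial of [rho_d], positivity and trace being read off the spectrum. The flag chart is shown
    in this way to take its values in M. *)
Lemma herm_isospectral rho : rho^t* = rho -> char_poly rho = char_poly rho_d ->
  exists Z (s : 'S_n), Z *m Z^t* = 1%:M /\ rho = spec_mx Z (d \o s).
Proof.
move=> /spectral_decomposition [Z [e [UZ ->]]].
rewrite rho_dE (char_poly_spec _ UZ) (char_poly_spec _ UZ0) => /prod_XsubC_perm [s es]; exists Z, s; split=> //.
by congr spec_mx; apply/funext => a; have /complexI := es a.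
Qed.

Lemma isospectral_spec rho : isospectral_manifold rho_d rho ->
  exists Z (s : 'S_n), Z *m Z^t* = 1%:M /\ rho = spec_mx Z (d \o s).
Proof. by move=> [[/herm_adjmxP hr _ _] cr]; exact: herm_isospectral. Qed.

End IsospectralManifold.

(** * Charts from flags *)

Section Interpolation.
Context {F : fieldType} {n : nat}.

(** Lagrange interpolation. At a diagonalizable matrix with simple spectrum, polynomials thus reach
    every matrix that is diagonal in the same basis: spectral projections, and [rho_d] itself at a
    critical point. *)
Lemma interpolation (z y : 'I_n -> F) : injective z ->
  exists g : {poly F}, forall a, g.[z a] = y a.
Proof.
move=> zi; exists (\sum_b (y b / \prod_(c | c != b) (z b - z c)) *:
  \prod_(c | c != b) ('X - (z c)%:P)) => a.
rewrite horner_sum (bigD1 a) //= [X in _ + X]big1 ?addr0 => [|b ba].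
  rewrite hornerZ horner_prod.
  have -> : \prod_(c | c != a) ('X - (z c)%:P).[z a] = \prod_(c | c != a) (z a - z c).
    by apply: eq_bigr => c _; rewrite hornerXsubC.
  rewrite divfK //; apply/prodf_neq0 => c ca; rewrite subr_eq0.
  by apply: contra_neq ca => /zi.
rewrite hornerZ horner_prod [X in _ * X](bigD1 a) /=; last by rewrite eq_sym.
by rewrite hornerXsubC subrr mul0r mulr0.
Qed.

End Interpolation.

(** * Orthogonal projections onto the steps of a flag *)

Section Truncation.
Context {R : realType} {n : nat}.
Local Notation C := R[i].
Local Notation M := 'M[C]_n.

Definition trunc_mx (k : nat) : M := diag_mx (\row_(a < n) ((a < k)%N%:R)).
Local Notation T := trunc_mx.

Lemma trunc_mull k {q} (A : 'M[C]_(n, q)) a b : (T k *m A) a b = (a < k)%N%:R * A a b.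
Proof. by rewrite mul_diag_mx !mxE. Qed.

Lemma trunc_mulr k {q} (A : 'M[C]_(q, n)) a b : (A *m T k) a b = A a b * (b < k)%N%:R.
Proof. by rewrite mul_mx_diag !mxE. Qed.

Lemma truncE k a b : T k a b = ((a < k)%N && (a == b))%:R.
Proof. by rewrite !mxE; case: (a < k)%N; case: (a == b). Qed.

Lemma trunc_mul j k : (j <= k)%N -> T j *m T k = T j.
Proof.
move=> jk; apply/matrixP => a b; rewrite trunc_mull !truncE.
case: (ltnP a j) => [aj|_]; last by rewrite mul0r.
by rewrite (leq_trans aj jk) mul1r.
Qed.

Lemma trunc_mulC j k : T j *m T k = T k *m T j.
Proof.
apply/matrixP => a b; rewrite !trunc_mull !truncE.
by case: (ltnP a j); case: (ltnP a k); case: eqP; rewrite ?mul1r ?mul0r ?mulr0 ?mulr1.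
Qed.

Lemma trunc_idem k : T k *m T k = T k. Proof. exact: trunc_mul. Qed.

Lemma trunc_adj k : (T k)^t* = T k.
Proof.
apply/matrixP => a b; rewrite adjE !truncE rmorph_nat eq_sym.
by case: eqP => [->|]; rewrite ?andbF.
Qed.

Lemma trunc0 : T 0 = 0.
Proof. by apply/matrixP => a b; rewrite truncE ltn0 mxE. Qed.

Lemma truncn : T n = 1%:M.
Proof. by apply/matrixP => a b; rewrite truncE ltn_ord mxE. Qed.

Lemma trunc_compl k : T k *m (1%:M - T k) = 0.
Proof. by rewrite mulmxBr mulmx1 trunc_idem subrr. Qed.

Definition lower_unitriangular (L : M) : Prop :=
  (forall a, L a a = 1) /\ (forall a b : 'I_n, (a < b)%N -> L a b = 0).

Lemma lower_unitriangular_unit L : lower_unitriangular L -> L \in unitmx.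
Proof.
move=> [L1 L0]; rewrite unitmxE det_trig; last by apply/is_trig_mxP.
by rewrite big1 ?unitr1.
Qed.

End Truncation.

(* [P] is the orthogonal projection onto the span of the columns of [L] kept by
   [T]; the summand [1 - T] makes the n x n Gram matrix [G] invertible. *)
Section GramProjection.
Context {R : realType} {n : nat}.
Local Notation M := 'M[R[i]]_n.
Variables T L G H P : M.
Hypothesis TT : T *m T = T.
Hypothesis T_adj : T^t* = T.
Hypothesis GE : G = T *m (L^t* *m L) *m T + (1%:M - T).
Hypothesis GH : G *m H = 1%:M.
Hypothesis PE : P = L *m T *m H *m (L *m T)^t*.

Let HG : H *m G = 1%:M. Proof. exact: mulmx1C. Qed.

Let T_compl : T *m (1%:M - T) = 0.
Proof. by rewrite mulmxBr mulmx1 TT subrr. Qed.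

Lemma gram_mulT : G *m T = T *m (L^t* *m L) *m T.
Proof. by rewrite GE mulmxDl mulmxBl mul1mx TT subrr addr0 -mulmxA TT. Qed.

(** [G] is the identity on the coordinates discarded by [T], hence so is its inverse [H]; this is
    how the added summand [1 - T] cancels from the formulas for [P]. *)
Lemma gram_compl : G *m (1%:M - T) = 1%:M - T.
Proof. by rewrite mulmxBr mulmx1 gram_mulT {1}GE addrC addKr. Qed.

Lemma gram_adj : G^t* = G.
Proof. by rewrite GE adjmxD adjmxB adjmx1 !adjmxM T_adj adjmxK !mulmxA. Qed.

Lemma invgram_adj : H^t* = H.
Proof.
have H1 : H^t* *m G = 1%:M by rewrite -{1}gram_adj -adjmxM GH adjmx1.
by rewrite -[H^t*]mulmx1 -GH mulmxA H1 mul1mx.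
Qed.

Lemma invgram_compl : H *m (1%:M - T) = 1%:M - T.
Proof. by rewrite -{1}gram_compl mulmxA HG mul1mx. Qed.

Lemma gram_frame : (L *m T)^t* *m (L *m T) = G - (1%:M - T).
Proof. by rewrite GE addrK adjmxM T_adj !mulmxA. Qed.

Lemma gram_proj_adj : P^t* = P.
Proof. by rewrite PE adjmxM adjmxK adjmxM invgram_adj mulmxA. Qed.

Lemma gram_proj_frame : P *m (L *m T) = L *m T.
Proof.
rewrite PE -mulmxA gram_frame mulmxBr -!mulmxA HG invgram_compl T_compl mulmx0.
by rewrite subr0 mulmx1.
Qed.

(** The trace is the rank of the projection. It later turns an inclusion between ranges of
    projections into an equality. *)
Lemma tr_gram_proj : \tr P = \tr T.
Proof.
rewrite PE mxtrace_mulC mulmxA gram_frame mxtrace_mulC mulmxBr HG invgram_compl.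
by rewrite opprB addrC subrK.
Qed.

End GramProjection.

Section FlagProj.
Context {R : realType} {n : nat}.
Local Notation M := 'M[R[i]]_n.
Local Notation T := (@trunc_mx R n).

Definition gram (L : M) k : M := T k *m (L^t* *m L) *m T k + (1%:M - T k).
Definition flag_proj (L : M) k : M := L *m T k *m invmx (gram L k) *m (L *m T k)^t*.

Variable L : M.
Hypothesis uL : lower_unitriangular L.

Let L_unit := lower_unitriangular_unit uL.

(** Let v G = 0. Then v (1 - T) = 0, since G is the identity there, and v T L^* L T v^* = 0 forces L
    T v^* = 0 by positivity; as [L] is invertible, v T = 0 too. *)
Lemma gram_unit k : gram L k \in unitmx.
Proof.
rewrite unitmxE unitfE; apply/det0P => -[v v0].
move: (gram_mulT (trunc_idem k) erefl : gram L k *m T k = _)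
      (gram_compl (trunc_idem k) erefl : gram L k *m _ = _).
move: (gram L k) => G gT gC vG.
have v1 : v *m (1%:M - T k) = 0 by rewrite -gC mulmxA vG mul0mx.
have v2 : v *m (T k *m (L^t* *m L) *m T k) = 0 by rewrite -gT mulmxA vG mul0mx.
have v3 : L *m T k *m v^t* = 0.
  apply: tr_adjmx_eq0; rewrite !adjmxM trunc_adj adjmxK.
  move: v2 => /(congr1 (mulmx^~ (v^t*))); rewrite mul0mx !mulmxA => ->.
  by rewrite mxtrace0.
have v4 : T k *m v^t* = 0.
  by have := congr1 (mulmx (invmx L)) v3; rewrite -mulmxA mulKmx // mulmx0.
have v5 : v *m T k = 0.
  by have := congr1 (fun A => A^t*) v4; rewrite adjmxM adjmxK trunc_adj adjmx0.
by case/eqP: v0; move: v1; rewrite mulmxBr mulmx1 v5 subr0.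
Qed.

Let gramV k := mulmxV (gram_unit k).

Lemma flag_proj_adj k : (flag_proj L k)^t* = flag_proj L k.
Proof.
exact: (gram_proj_adj (trunc_adj k) erefl (gramV k) erefl).
Qed.

Lemma flag_proj_frame k : flag_proj L k *m (L *m T k) = L *m T k.
Proof.
exact: (gram_proj_frame (trunc_idem k) (trunc_adj k) erefl (gramV k) erefl).
Qed.

Lemma tr_flag_proj k : \tr (flag_proj L k) = \tr (T k).
Proof.
exact: (tr_gram_proj (trunc_idem k) (trunc_adj k) erefl (gramV k) erefl).
Qed.

Lemma flag_proj_frame_le j k : (j <= k)%N ->
  flag_proj L k *m (L *m T j) = L *m T j.
Proof.
move=> jk; have E : L *m T j = L *m T k *m T j.
  by rewrite -mulmxA [T k *m _]trunc_mulC trunc_mul.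
by rewrite E mulmxA flag_proj_frame.
Qed.

Lemma flag_proj_factor j : exists A, flag_proj L j = L *m T j *m A.
Proof. by eexists; rewrite /flag_proj -[LHS]mulmxA; reflexivity. Qed.

Lemma flag_proj_mul j k : (j <= k)%N -> flag_proj L k *m flag_proj L j = flag_proj L j.
Proof.
move=> jk; have [A ->] := flag_proj_factor j.
by rewrite mulmxA flag_proj_frame_le.
Qed.

Lemma flag_proj_mulC j k : (j <= k)%N -> flag_proj L j *m flag_proj L k = flag_proj L j.
Proof.
move=> jk; have := congr1 (fun A => A^t*) (flag_proj_mul jk).
by rewrite adjmxM !flag_proj_adj.
Qed.

Lemma flag_proj0 : flag_proj L 0 = 0.
Proof. by have [A ->] := flag_proj_factor 0; rewrite trunc0 mulmx0 mul0mx. Qed.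

Lemma flag_projn : flag_proj L n = 1%:M.
Proof.
have := flag_proj_frame n; rewrite truncn mulmx1 => /(congr1 (mulmx^~ (invmx L))).
by rewrite -mulmxA mulmxV ?mulmx1.
Qed.

End FlagProj.

Section ProjectionFlag.
Context {R : realType} {n : nat}.
Local Notation C := R[i].
Variables (P : nat -> 'M[C]_n).
Hypothesis P_mul : forall j k, (j <= k)%N -> P k *m P j = P j.
Hypothesis P_mulC : forall j k, (j <= k)%N -> P j *m P k = P j.
Hypothesis P0 : P 0 = 0.
Hypothesis Pn : P n = 1%:M.
Local Notation E a := (P a.+1 - P a).

(** The increments of a nested chain of projections are mutually orthogonal idempotents. They play
    the role of rank-one spectral projections without any choice of eigenvectors. *)
Lemma flag_step_mul (a b : nat) : E a *m E b = if a == b then E a else 0.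
Proof.
rewrite mulmxBl !mulmxBr; case: (ltngtP a b) => ab.
- rewrite (P_mulC (_ : a.+1 <= b.+1)%N) ?(P_mulC (_ : a.+1 <= b)%N) //; last exact: ltnW.
  by rewrite (P_mulC (_ : a <= b.+1)%N) ?(P_mulC (ltnW ab)) ?subrr // (leq_trans (ltnW ab)).
- rewrite (P_mul (_ : b.+1 <= a.+1)%N) ?(P_mul (_ : b.+1 <= a)%N) //; last exact: ltnW.
  by rewrite (P_mul (_ : b <= a.+1)%N) ?(P_mul (ltnW ab)) ?subrr // (leq_trans (ltnW ab)).
- by rewrite ab (P_mulC (leqnSn b)) !P_mul // subrr subr0.
Qed.

Lemma sum_flag_step k : (k <= n)%N -> \sum_(a < n | (a < k)%N) E a = P k.
Proof.
move=> kn; rewrite -(big_mkord (fun a => a < k)%N (fun a => E a)).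
by rewrite -(big_nat_widen 0 k n xpredT) // telescope_sumr // P0 subr0.
Qed.

Lemma sum_flag_step_all : \sum_(a < n) E a = 1%:M.
Proof.
rewrite -Pn -sum_flag_step //; apply: eq_bigl => a; by rewrite ltn_ord.
Qed.

Lemma flag_comb_mul (f g : 'I_n -> C) :
  (\sum_a f a *: E a) *m (\sum_a g a *: E a) = \sum_a (f a * g a) *: E a.
Proof.
rewrite mulmx_suml; apply: eq_bigr => a _; rewrite mulmx_sumr (bigD1 a) //= big1.
  by rewrite addr0 -scalemxAl -scalemxAr flag_step_mul eqxx scalerA.
move=> b ba; rewrite -scalemxAl -scalemxAr flag_step_mul eq_sym.
by rewrite (_ : (b == a :> nat) = false) ?scaler0 //; exact/negbTE.
Qed.

End ProjectionFlag.

(** Polynomial functional calculus: combinations of the increments multiply coefficientwise, and the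
    increments add up to the identity. *)
Lemma horner_flag_comb {R : realType} {n0 : nat} (P : nat -> 'M[R[i]]_n0.+1)
   (z : 'I_n0.+1 -> R[i]) (g : {poly R[i]}) :
  (forall j k, (j <= k)%N -> P k *m P j = P j) ->
  (forall j k, (j <= k)%N -> P j *m P k = P j) ->
  P 0 = 0 -> P n0.+1 = 1%:M ->
  horner_mx (\sum_a z a *: (P a.+1 - P a)) g = \sum_a g.[z a] *: (P a.+1 - P a).
Proof.
move=> Pm PmC P0 Pn; elim/poly_ind: g => [|g c IH].
  by rewrite rmorph0 big1 // => a _; rewrite horner0 scale0r.
rewrite rmorphD rmorphM /= horner_mx_X horner_mx_C IH -[_ * _]/(_ *m _) flag_comb_mul //.
rewrite -scalemx1 -(sum_flag_step_all P0 Pn) scaler_sumr -big_split /=.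
by apply: eq_bigr => a _; rewrite -scalerDl hornerMXaddC.
Qed.

(** * From unitriangular frames to isospectral matrices and back *)

Section FlagChart.
Context {R : realType} {n0 : nat}.
Local Notation C := R[i].
Local Notation n := n0.+1.
Local Notation M := 'M[C]_n.
Local Notation T := (@trunc_mx R n).

Lemma adjmxZ_real {p q} (c : R) (A : 'M[C]_(p, q)) : (c%:C%C *: A)^t* = c%:C%C *: A^t*.
Proof.
apply/matrixP => i j; rewrite [RHS]mxE !adjE mxE rmorphM; congr (_ * _).
exact: conj_real.
Qed.

Lemma adjmx_sum {p q} (I : Type) (r : seq I) (A : I -> 'M[C]_(p, q)) :
  (\sum_(i <- r) A i)^t* = \sum_(i <- r) (A i)^t*.
Proof.
by elim: r => [|i r IH]; rewrite ?big_nil ?adjmx0 // !big_cons adjmxD IH.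
Qed.

Lemma horner_spec_mx (Z : M) (e : 'I_n -> R) (g : {poly C}) : Z *m Z^t* = 1%:M ->
  horner_mx (spec_mx Z e) g = Z *m diag_mx (\row_a g.[(e a)%:C%C]) *m Z^t*.
Proof.
move=> UZ; have ZV : Z^t* = invmx Z.
  have Zu : Z \in unitmx by have [] := mulmx1_unit UZ.
  by rewrite -[RHS]mulmx1 -UZ mulKmx.
have Zu : Z \is a GRing.unit by have [] := mulmx1_unit UZ.
rewrite /spec_mx ZV (horner_mx_uconj _ _ Zu) horner_mx_diag; congr (_ *m diag_mx _ *m _).
by apply/rowP => a; rewrite !mxE.
Qed.

Variables (l : 'I_n -> R) (F : nat -> {poly C}).
Hypothesis FE : forall k a, (F k).[(l a)%:C%C] = (a < k)%N%:R.

(** The matrix with eigenvalue [l a] on the a-th increment of the flag spanned by the columns of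
    [L]. The polynomial [F k] is 1 at the first k values of [l] and 0 at the others, so it recovers
    the k-th projection. *)
Definition flag_chart (L : M) : M :=
  \sum_a (l a)%:C%C *: (flag_proj L a.+1 - flag_proj L a).

(* Kato's operator intertwines the projections [horner_mx rho (F k)] and [T k]. *)
Definition kato k (rho : M) : M :=
  (1%:M - T k) *m (1%:M - horner_mx rho (F k)) + T k *m horner_mx rho (F k).

Definition frame_of (rho : M) : M := \matrix_(i, a) invmx (kato a.+1 rho) i a.

Section FromFrame.
Variable L : M.
Hypothesis uL : lower_unitriangular L.

Lemma horner_flag_chart g : horner_mx (flag_chart L) g =
  \sum_a g.[(l a)%:C%C] *: (flag_proj L a.+1 - flag_proj L a).
Proof.
apply: (horner_flag_comb (fun a => (l a)%:C%C)).
- exact: flag_proj_mul.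
- exact: flag_proj_mulC.
- exact: flag_proj0.
- exact: flag_projn.
Qed.

Lemma horner_flag_chart_proj k : (k <= n)%N ->
  horner_mx (flag_chart L) (F k) = flag_proj L k.
Proof.
move=> kn; rewrite horner_flag_chart -(sum_flag_step (flag_proj0 L) kn).
rewrite [RHS]big_mkcond; apply: eq_bigr => a _; rewrite FE.
by case: ifP; rewrite ?scale1r ?scale0r.
Qed.

Lemma flag_chart_adj : (flag_chart L)^t* = flag_chart L.
Proof.
rewrite /flag_chart adjmx_sum; apply: eq_bigr => a _.
by rewrite adjmxZ_real adjmxB !flag_proj_adj.
Qed.

(** Column [a] lies in the span of the first a + 1 columns, so the projection fixes it and the term
    in [1 - T] vanishes. What remains is the column cut after its diagonal entry: zeros above the
    diagonal, then 1. *)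
Lemma kato_frame (a : 'I_n) : kato a.+1 (flag_chart L) *m col a L = delta_mx a 0.
Proof.
have E : col a L = L *m T a.+1 *m delta_mx a 0.
  rewrite colE -mulmxA; congr (_ *m _); apply/matrixP => i j.
  rewrite trunc_mull mxE; case: eqP => [->|_]; rewrite ?mulr0 //.
  by rewrite ltnS leqnn mul1r.
have PL : flag_proj L a.+1 *m col a L = col a L.
  by rewrite E mulmxA flag_proj_frame.
have CL : (1%:M - flag_proj L a.+1) *m col a L = 0 by rewrite mulmxBl mul1mx PL subrr.
rewrite /kato horner_flag_chart_proj //; move: (flag_proj _ _) PL CL => Pi PL CL.
rewrite mulmxDl -!mulmxA CL PL mulmx0 add0r; apply/matrixP => i j; rewrite trunc_mull !mxE ord1 eqxx andbT.
have [L1 L0] := uL; rewrite ltnS; case: (ltngtP i a) => ia.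
- by rewrite L0 // mulr0 (_ : (i == a) = false) //; apply/negbTE; rewrite neq_ltn ia.
- by rewrite mul0r (_ : (i == a) = false) //; apply/negbTE; rewrite neq_ltn ia orbT.
- by have /val_inj -> := ia; rewrite L1 mul1r eqxx.
Qed.

Lemma frame_of_flag_chart : (forall a : 'I_n, kato a.+1 (flag_chart L) \in unitmx) ->
  frame_of (flag_chart L) = L.
Proof.
move=> ku; apply/matrixP => i a; rewrite mxE.
have := kato_frame a; move: (ku a); move: (kato _ _) => K Ku.
move=> /(congr1 (mulmx (invmx K))); rewrite mulKmx // -colE => /matrixP/(_ i 0).
by rewrite !mxE => ->.
Qed.

(** Gram-Schmidt without normalization: column [a] of [S] is column [a] of [L] minus its projection
    on the earlier columns, an eigenvector for [l a]. An invertible [S] therefore diagonalizes the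
    chart. *)
Lemma flag_chart_char_poly :
  char_poly (flag_chart L) = \prod_a ('X - ((l a)%:C%C)%:P).
Proof.
pose E (a : 'I_n) := flag_proj L a.+1 - flag_proj L a.
pose S := \sum_a E a *m L *m delta_mx a a.
have EE (a b : 'I_n) : E a *m E b = if a == b then E a else 0.
  by apply: flag_step_mul; [exact: flag_proj_mul | exact: flag_proj_mulC].
have SE : flag_chart L *m S = S *m real_diag l.
  rewrite /S mulmx_sumr mulmx_suml; apply: eq_bigr => a _.
  have -> : flag_chart L *m (E a *m L *m delta_mx a a) =
     (l a)%:C%C *: (E a *m L *m delta_mx a a).
    rewrite !mulmxA !scalemxAl; congr (_ *m _ *m _).
    rewrite /flag_chart mulmx_suml (bigD1 a) //= big1 => [|b ba].
      by rewrite -scalemxAl EE eqxx addr0.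
    by rewrite -scalemxAl EE (negPf ba) scaler0.
  rewrite -[RHS]mulmxA scalemxAr; congr (_ *m _); apply/matrixP => i j.
  rewrite mul_mx_diag !mxE; case: eqP => _; rewrite ?mulr0 ?mul0r //=.
  by case: eqP => [->|_]; rewrite ?mulr0 ?mul0r // mulr1 mul1r.
have /choice [X XE] : forall a : 'I_n, exists A, flag_proj L a = L *m T a *m A.
  by move=> a; exact: flag_proj_factor.
(* The part subtracted from column [a] is a combination of the columns of [L] of index less than
   [a], so [V] is upper unitriangular. *)
pose V : M := 1%:M - \sum_(a < n) T a *m X a *m L *m delta_mx a a.
have SV : S = L *m V.
  rewrite /V mulmxBr mulmx1 mulmx_sumr.
  have LE : \sum_a L *m delta_mx a a = L.
    rewrite -mulmx_sumr -[RHS]mulmx1; congr (_ *m _); apply/matrixP => i j.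
    rewrite summxE mxE (bigD1 i) //= mxE eqxx /= big1 ?addr0 1?eq_sym // => b bi.
    by rewrite mxE [i == b]eq_sym (negPf bi).
  rewrite -{1}LE -sumrB; apply: eq_bigr => a _.
  have PL : flag_proj L a.+1 *m (L *m delta_mx a a) = L *m delta_mx a a.
    have {1 2}-> : delta_mx a a = T a.+1 *m delta_mx a a :> M.
      apply/matrixP => i j; rewrite trunc_mull mxE.
      by case: eqP => [->|_]; rewrite ?mulr0 // ltnS leqnn mul1r.
    by rewrite !mulmxA -[X in X *m _]mulmxA flag_proj_frame.
  by rewrite -mulmxA mulmxBl PL XE !mulmxA.
have uV : V \in unitmx.
  rewrite -unitmx_tr unitmxE det_trig.
    rewrite big1 ?unitr1 // => i _; rewrite !mxE eqxx summxE big1 ?subr0 // => a _.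
    rewrite -!mulmxA trunc_mull; have [ai|ai] := ltnP i a; last by rewrite mul0r.
    rewrite !mulmxA mxE big1 ?mulr0 // => j _.
    by rewrite [delta_mx _ _ _ _]mxE andbC; case: eqP => [E'|_]; rewrite ?mulr0 //; rewrite E' ltnn in ai.
  apply/is_trig_mxP => i j ij; rewrite !mxE (_ : (j == i) = false); last first.
    by apply/negbTE; rewrite neq_ltn ij orbT.
  rewrite summxE big1 ?subr0 // => a _.
  rewrite -!mulmxA trunc_mull; have [ai|ai] := ltnP j a; last by rewrite mul0r.
  rewrite !mulmxA mxE big1 ?mulr0 // => k _.
  rewrite [delta_mx _ _ _ _]mxE andbC; case: eqP => [E'|_]; rewrite ?mulr0 //.
  by rewrite -E' ltnNge ltnW in ai.
have uS : S \in unitmx by rewrite SV unitmx_mul (lower_unitriangular_unit uL).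
have -> : flag_chart L = S *m real_diag l *m invmx S by rewrite -SE mulmxK.
by rewrite char_poly_conj ?mulmxV // char_poly_real_diag.
Qed.

End FromFrame.

Section ToFrame.
Variables (Z : M) (t : 'S_n).
Hypothesis UZ : Z *m Z^t* = 1%:M.
Local Notation rho := (spec_mx Z (l \o t)).
Hypothesis ku : forall a : 'I_n, kato a.+1 rho \in unitmx.
Local Notation P k := (horner_mx rho (F k)).

Let UZ' : Z^t* *m Z = 1%:M. Proof. exact: mulmx1C. Qed.

Lemma spec_projE k : P k = Z *m diag_mx (\row_a ((t a < k)%N%:R)) *m Z^t*.
Proof.
rewrite (horner_spec_mx _ _ UZ); congr (_ *m diag_mx _ *m _); apply/rowP => a.
by rewrite !mxE /= FE.
Qed.

Lemma spec_proj_mul j k : (j <= k)%N -> P j *m P k = P j /\ P k *m P j = P j.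
Proof.
move=> jk; have H a : (t a < j)%N%:R * (t a < k)%N%:R = (t a < j)%N%:R :> C.
  case: (ltnP (t a) j) => taj; last by rewrite mul0r.
  by rewrite (leq_trans taj jk) mul1r.
have K (u v : 'rV[C]_n) : Z *m diag_mx u *m Z^t* *m (Z *m diag_mx v *m Z^t*) =
   Z *m diag_mx (\row_a (u 0 a * v 0 a)) *m Z^t*.
  rewrite !mulmxA; congr (_ *m _); rewrite -!mulmxA; congr (_ *m _).
  by rewrite [Z^t* *m _]mulmxA UZ' mul1mx mulmx_diag.
split; rewrite !spec_projE K; congr (_ *m diag_mx _ *m _); apply/rowP => a.
  by rewrite !mxE H.
by rewrite !mxE mulrC H.
Qed.

Lemma spec_proj_adj k : (P k)^t* = P k.
Proof.
rewrite spec_projE !adjmxM adjmxK mulmxA; congr (_ *m _ *m _).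
apply/matrixP => a b; rewrite adjE !mxE eq_sym; case: eqP => [->|_].
  by rewrite !mulr1n rmorph_nat.
by rewrite !mulr0n rmorph0.
Qed.

Lemma tr_spec_proj k : \tr (P k) = \tr (T k).
Proof.
rewrite spec_projE mxtrace_mulC mulmxA UZ' mul1mx /mxtrace.
rewrite [RHS](reindex_inj (@perm_inj _ t)); apply: eq_bigr => a _.
by rewrite !mxE !eqxx.
Qed.

(** From K P = T K follows P K^-1 = K^-1 T, so [P] fixes the column c = K^-1 e_a. On such a vector
    the term (1 - T)(1 - P) of [K] vanishes, whence T c = T P c = K c = e_a. *)
Lemma frame_of_col (a : 'I_n) : P a.+1 *m col a (frame_of rho) = col a (frame_of rho) /\
  T a.+1 *m col a (frame_of rho) = delta_mx a 0.
Proof.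
have -> : col a (frame_of rho) = invmx (kato a.+1 rho) *m delta_mx a 0.
  by apply/matrixP => i j; rewrite -colE !mxE.
have [PP _] := spec_proj_mul (leqnn a.+1).
have Ta : T a.+1 *m delta_mx a 0 = delta_mx a 0 :> 'cV[C]_n.
  apply/matrixP => i j; rewrite trunc_mull mxE.
  by case: eqP => [->|_]; rewrite ?mulr0 // ltnS leqnn mul1r.
have KP : kato a.+1 rho *m P a.+1 = T a.+1 *m kato a.+1 rho.
  rewrite /kato; move: (P a.+1) PP => Q QQ.
  have QC : (1%:M - Q) *m Q = 0 by rewrite mulmxBl mul1mx QQ subrr.
  rewrite mulmxDl mulmxDr -!mulmxA QC QQ mulmx0 add0r.
  by rewrite !mulmxA trunc_compl mul0mx add0r trunc_idem.
have KQ : T a.+1 *m P a.+1 + (1%:M - T a.+1) *m (1%:M - P a.+1) = kato a.+1 rho.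
  by rewrite addrC.
move: (ku a) KP KQ PP; move: (kato a.+1 rho) (P a.+1) => K Q Ku KP KQ QQ.
have QK : Q *m invmx K = invmx K *m T a.+1.
  by rewrite -[LHS](mulKmx Ku) [K *m (Q *m _)]mulmxA KP mulmxK.
have QL : Q *m (invmx K *m delta_mx a 0) = invmx K *m (delta_mx a 0 : 'cV[C]_n).
  by rewrite mulmxA QK -mulmxA Ta.
split=> //; rewrite -{1}QL mulmxA.
have -> : T a.+1 *m Q = K - (1%:M - T a.+1) *m (1%:M - Q) by rewrite -KQ addrK.
have QZ : (1%:M - Q) *m (invmx K *m delta_mx a 0) = 0 :> 'cV[C]_n.
  by rewrite mulmxBl mul1mx QL subrr.
by rewrite mulmxBl mulKVmx // -[_ *m (1%:M - Q) *m _]mulmxA QZ mulmx0 subr0.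
Qed.

Lemma frame_of_lower_unitriangular : lower_unitriangular (frame_of rho).
Proof.
have H (a i : 'I_n) : (i <= a)%N -> frame_of rho i a = (i == a)%:R.
  move=> ia; have [_ /matrixP/(_ i 0)] := frame_of_col a.
  by rewrite trunc_mull ltnS ia mul1r !mxE andbT => <-.
split=> [a|a b ab]; rewrite H ?eqxx //; last exact: ltnW.
by rewrite (_ : (a == b) = false) //; apply/negbTE; rewrite neq_ltn ab.
Qed.

(** The frame columns kept by [T k] lie in the range of P = [P k], so the projection Q on their span
    satisfies P Q = Q P = Q. As the traces agree, tr ((P - Q)^2) = tr P - tr Q = 0. *)
Lemma flag_proj_frame_of k : flag_proj (frame_of rho) k = P k.
Proof.
have uL := frame_of_lower_unitriangular.
set L := frame_of rho in uL *.
have PB : P k *m (L *m T k) = L *m T k.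
  apply/matrixP => i a; rewrite mulmxA !trunc_mulr.
  case: (ltnP a k) => ak; last by rewrite !mulr0.
  congr (_ * _); have [PL _] := frame_of_col a.
  have := congr1 (mulmx (P k)) PL; rewrite mulmxA (spec_proj_mul ak).2 PL.
  by rewrite -/L !colE mulmxA -!colE => /matrixP/(_ i 0); rewrite !mxE.
have PPi : P k *m flag_proj L k = flag_proj L k.
  by have [A ->] := flag_proj_factor L k; rewrite mulmxA PB.
have PiP : flag_proj L k *m P k = flag_proj L k.
  have := congr1 adjoint PPi; by rewrite adjmxM flag_proj_adj // spec_proj_adj.
have [PP _] := spec_proj_mul (leqnn k).
have Pa := spec_proj_adj k; have trP := tr_spec_proj k.
have trPi := tr_flag_proj uL k; have Pia := flag_proj_adj uL k.
have PiPi := flag_proj_mul uL (leqnn k).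
move: (P k) (flag_proj L k) PPi PiP PP Pa trP trPi Pia PiPi => Q Pi QPi PiQ QQ Qa tQ tPi Pia PiPi.
apply/eqP; rewrite eq_sym -subr_eq0; apply/eqP; apply: tr_adjmx_eq0.
rewrite adjmxB Qa Pia mulmxBl !mulmxBr QQ QPi PiQ PiPi subrr subr0.
by rewrite linearB /= tQ tPi subrr.
Qed.

Lemma flag_chart_frame_of : flag_chart (frame_of rho) = rho.
Proof.
rewrite /flag_chart; under eq_bigr do rewrite !flag_proj_frame_of !spec_projE.
rewrite /spec_mx.
have E : real_diag (l \o t) = \sum_a (l a)%:C%C *:
   (diag_mx (\row_b ((t b < a.+1)%N%:R)) - diag_mx (\row_b ((t b < a)%N%:R))).
  apply/matrixP => i j; rewrite summxE real_diagE.
  rewrite (bigD1 (t i)) //= big1 ?addr0 => [|a ai]; rewrite !mxE.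
    by rewrite ltnS leqnn ltnn; case: eqP => _; rewrite ?mulr1n ?mulr0n ?subr0 ?mulr1 ?mulr0.
  rewrite ltnS leq_eqVlt (_ : (t i == a :> nat) = false) /= ?subrr ?mulr0 //.
  by apply/negbTE; rewrite eq_sym.
rewrite E mulmx_sumr mulmx_suml; apply: eq_bigr => a _.
by rewrite -scalemxAr -scalemxAl mulmxBr mulmxBl.
Qed.

End ToFrame.
End FlagChart.

Lemma offdiag_index n m : (2 <= n)%N -> m = (n ^ 2 - n)%N ->
  exists (pr : 'I_m -> 'I_n * 'I_n) (idx : 'I_n * 'I_n -> 'I_m),
    [/\ forall j, (pr j).1 != (pr j).2, cancel pr idx &
        forall p, p.1 != p.2 -> pr (idx p) = p].
Proof.
case: n => [|[|n']] // _; set n := n'.+2 => mE; pose A := [set p : 'I_n * 'I_n | p.1 != p.2]%SET.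
have cA : #|A| = m.
  have -> : A = (~: [set (i, i) | i : 'I_n])%SET.
    apply/setP => -[i j]; rewrite !inE /=; congr (~~ _).
    apply/eqP/imsetP => [->|[k _ [-> ->]] //]; by exists j.
  rewrite cardsCs finset.setCK card_imset => [|i j [->] //].
  by rewrite card_prod !card_ord mE mulnn.
(* A default element for [enum_rank_in], off the diagonal because n is at least 2; [idx] takes its
   index on diagonal pairs. *)
have A0 : (ord0, ord_max) \in A by rewrite inE.
exists (fun j => enum_val (cast_ord (esym cA) j)),
  (fun p => cast_ord cA (enum_rank_in A0 p)); split.
- by move=> j; have := enum_valP (cast_ord (esym cA) j); rewrite inE.
- by move=> j; rewrite enum_valK_in cast_ordKV.
- by move=> p pA; rewrite cast_ordK enum_rankK_in // inE.
Qed.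

Lemma is_derive_coord {R : realType} {m : nat} (j : 'I_m) (x v : 'rV[R]_m) :
  is_derive x v (fun y : 'rV[R]_m => y 0 j) (v 0 j).
Proof.
apply: (@is_derive_linear R 'rV[R]_m 'rV[R]_m R
  (fun A : 'rV[R]_m => A 0 j) id x v); [by move=> a A B; rewrite !mxE|exact: coord_continuous].
Qed.

Lemma continuous_row {R : realType} {T : topologicalType} {m : nat}
    (g : T -> 'rV[R]_m) (x : T) :
  (forall j, {for x, continuous (fun y => g y 0 j)}) -> {for x, continuous g}.
Proof.
move=> cg; have -> : g = fun y => \sum_j g y 0 j *: delta_mx 0 j.
  by apply/funext => y; exact: row_sum_delta.
elim: (index_enum _) => [|j r IH].
  have -> : (fun y => \sum_(j <- [::]) g y 0 j *: delta_mx 0 j) = fun=> 0 :> 'rV[R]_m.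
    by apply/funext => y; rewrite big_nil.
  exact: cst_continuous.
have -> : (fun y => \sum_(i <- j :: r) g y 0 i *: delta_mx 0 i) =
   fun y => g y 0 j *: delta_mx 0 j + \sum_(i <- r) g y 0 i *: delta_mx 0 i :> 'rV[R]_m.
  by apply/funext => y; rewrite big_cons.
have H : {for x, continuous (fun y => g y 0 j *: (delta_mx 0 j : 'rV[R]_m))}.
  by apply: cvgZr_tmp; exact: cg.
exact: (cvgD H IH).
Qed.

(** * Real coordinates on the flag chart *)

Section Parametrization.
Context {R : realType} {n0 m : nat}.
Local Notation C := R[i].
Local Notation n := n0.+1.
Local Notation M := 'M[C]_n.
Local Notation T := (@trunc_mx R n).
Local Notation smooth := (@smooth_on R m R setT).
Variables (pr : 'I_m -> 'I_n * 'I_n) (idx : 'I_n * 'I_n -> 'I_m).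
Hypothesis pr_neq : forall j, (pr j).1 != (pr j).2.
Hypothesis prK : cancel pr idx.
Hypothesis idxK : forall p, p.1 != p.2 -> pr (idx p) = p.

(* The real coordinates indexed by (a, b) and (b, a), with b < a, are the real and
   the imaginary part of the entry (a, b). *)
Definition frame (x : 'rV[R]_m) : M := \matrix_(a, b)
  if a == b then 1 else
  if (b < a)%N then Complex (x 0 (idx (a, b))) (x 0 (idx (b, a))) else 0.

Definition frame_coords (L : M) : 'rV[R]_m := \row_j
  if ((pr j).2 < (pr j).1)%N then complex.Re (L (pr j).1 (pr j).2)
  else complex.Im (L (pr j).2 (pr j).1).

Lemma frame_lower x : lower_unitriangular (frame x).
Proof.
split=> [a|a b ab]; rewrite mxE ?eqxx //.
by rewrite (_ : (a == b) = false) ?ltnNge ?(ltnW ab) //; apply/negbTE; rewrite neq_ltn ab.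
Qed.

Lemma frameK : cancel frame frame_coords.
Proof.
move=> x; apply/rowP => j; rewrite !mxE; have := pr_neq j.
case E : (pr j) => [a b] /= ab; case: ltnP => ba.
  by rewrite (negPf ab) /= -E prK.
rewrite eq_sym (negPf ab) ltn_neqAle ba andbT (_ : (a != b :> nat)) //=.
by rewrite -E prK.
Qed.

Lemma frame_coordsK L : lower_unitriangular L -> frame (frame_coords L) = L.
Proof.
move=> [L1 L0]; apply/matrixP => a b; rewrite mxE.
have [->|ab] := eqVneq a b; first by rewrite L1.
case: ltnP => ba; last by rewrite L0 // ltn_neqAle ba andbT.
rewrite !mxE !idxK //= 1?eq_sym // ba ltnNge (ltnW ba) /=.
by case: (L a b).
Qed.

Lemma frame0 : frame 0 = 1%:M.
Proof.
apply/matrixP => a b; rewrite !mxE; case: eqP => // _; by case: ifP.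
Qed.

(** [frame] is affine with value 1 at the origin, so its linear part is [frame v - 1]. *)
Lemma is_mder_frame x v : is_mder frame x v (frame v - 1%:M).
Proof.
move=> a b; have -> : (fun y => frame y a b) = fun y : 'rV[R]_m =>
   if a == b then 1 else if (b < a)%N then Complex (y 0 (idx (a, b))) (y 0 (idx (b, a))) else 0.
  by apply/funext => y; rewrite mxE.
rewrite !mxE; case: eqP => _ /=; first by rewrite subrr; exact: is_cder_cst.
rewrite subr0; case: ifP => _; last exact: is_cder_cst.
by split; exact: is_derive_coord.
Qed.

Lemma frame_smooth : mx_in smooth frame.
Proof.
move=> a b; have -> : (fun y => frame y a b) = fun y : 'rV[R]_m =>
   if a == b then 1 else if (b < a)%N then Complex (y 0 (idx (a, b))) (y 0 (idx (b, a))) else 0.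
  by apply/funext => y; rewrite mxE.
have alg := @smooth_fun_algebra R m _ openT.
case: eqP => _; first exact: (cplx_in_cst alg).
case: (b < a)%N; last exact: (cplx_in_cst alg).
by split=> k; apply: Ck_on_coord; exact: openT.
Qed.

Variables (l : 'I_n -> R) (F : nat -> {poly C}).
Hypothesis FE : forall k a, (F k).[(l a)%:C%C] = (a < k)%N%:R.

Definition flag_param (Z : M) (x : 'rV[R]_m) : M := Z *m flag_chart l (frame x) *m Z^t*.

Lemma flag_chart_smooth : mx_in smooth (fun x => flag_chart l (frame x)).
Proof.
have alg := @smooth_fun_algebra R m _ openT.
have SP k : mx_in smooth (fun x => flag_proj (frame x) k).
  have SG : mx_in smooth (fun x => invmx (gram (frame x) k)).
    apply: (mx_in_inv alg); first by move=> x _; apply: gram_unit; exact: frame_lower.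
    apply: (mx_in_add alg); last exact: (mx_in_cst alg).
    apply: (mx_in_mul alg); last exact: (mx_in_cst alg).
    apply: (mx_in_mul alg); first exact: (mx_in_cst alg).
    apply: (mx_in_mul alg); last exact: frame_smooth.
    by apply: (mx_in_adj alg); exact: frame_smooth.
  have SL : mx_in smooth (fun x => frame x *m T k).
    by apply: (mx_in_mul alg); [exact: frame_smooth | exact: (mx_in_cst alg)].
  by apply: (mx_in_mul alg); [apply: (mx_in_mul alg) | apply: (mx_in_adj alg)].
apply: (mx_in_sum alg) => a; apply: (mx_in_scale alg); first exact: (cplx_in_cst alg).
exact: (mx_in_sub alg).
Qed.

Lemma flag_param_smooth Z : mx_in smooth (flag_param Z).
Proof.
have alg := @smooth_fun_algebra R m _ openT.
apply: (mx_in_mul alg); last exact: (mx_in_cst alg).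
by apply: (mx_in_mul alg); [exact: (mx_in_cst alg) | exact: flag_chart_smooth].
Qed.

Lemma flag_proj1 k : flag_proj (1%:M : M) k = T k.
Proof.
have G1 : gram (1%:M : M) k = 1%:M.
  by rewrite /gram adjmx1 !mulmx1 trunc_idem addrC subrK.
by rewrite /flag_proj G1 invmx1 mulmx1 mul1mx trunc_adj trunc_idem.
Qed.

Lemma flag_chart1 : flag_chart l 1%:M = real_diag l.
Proof.
rewrite /flag_chart; under eq_bigr do rewrite !flag_proj1.
apply/matrixP => i j.
have SE (c : C) (A B : M) : (c *: (A - B)) i j = c * (A i j - B i j) by rewrite !mxE.
rewrite summxE real_diagE (bigD1 i) //= big1 ?addr0 => [|a ai].
  rewrite SE !truncE ltnS leqnn ltnn.
  by case: eqP => _; rewrite ?subr0 ?mulr1 ?mulr0 ?mulr1n ?mulr0n.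
rewrite SE !truncE ltnS leq_eqVlt.
by rewrite (_ : (i == a :> nat) = false) /= ?subrr ?mulr0 //; apply/negbTE; rewrite eq_sym.
Qed.

(** In this form the projection occurs only once, and derivatives pass through multiplication by a
    constant matrix. *)
Lemma kato_affine k rho : kato F k rho =
  (1%:M - T k) + (T k - (1%:M - T k)) *m horner_mx rho (F k).
Proof.
rewrite /kato; move: (horner_mx _ _) => P.
by rewrite mulmxBr mulmx1 [in RHS]mulmxBl -addrA [- _ + _]addrC.
Qed.

(** A single complex function whose nonvanishing makes all the Kato operators invertible at once;
    the domain of the chart is thereby visibly open. *)
Definition kato_prod (rho : M) : C := \prod_(a < n) \det (kato F a.+1 rho).

Lemma kato_prod_neq0 rho : kato_prod rho != 0 ->
  forall a : 'I_n, kato F a.+1 rho \in unitmx.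
Proof. by move=> /prodf_neq0 H a; rewrite unitmxE unitfE H. Qed.

Lemma kato_prod_flag_chart1 : kato_prod (real_diag l) != 0.
Proof.
apply/prodf_neq0 => a _; rewrite -flag_chart1 -unitfE -unitmxE.
have u1 : lower_unitriangular (1%:M : M) by rewrite -frame0; exact: frame_lower.
have -> : kato F a.+1 (flag_chart l 1%:M) = 1%:M; last by rewrite unitmx1.
rewrite /kato (horner_flag_chart_proj FE u1) // flag_proj1.
by rewrite mulmxBr mulmx1 mulmxBl mul1mx trunc_idem subrr subr0 subrK.
Qed.

Lemma kato_prod_in {S : Type} (D : set S) (A : (S -> R) -> Prop) (G : S -> M) :
  fun_algebra D A -> mx_in A G -> cplx_in A (fun x => kato_prod (G x)).
Proof.
move=> alg SG; apply: (cplx_in_prod alg) => a; apply: (cplx_in_det alg).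
apply: (mx_in_add alg); apply: (mx_in_mul alg); try exact: (mx_in_cst alg).
  by apply: (mx_in_sub alg); [exact: (mx_in_cst alg) | exact: (mx_in_horner alg)].
exact: (mx_in_horner alg).
Qed.

(** If the derivative along [v] vanishes, so does that of each Kato operator K. Differentiating the
    constant K(x) (frame x) e_a = e_a leaves K(x) (frame v - 1) e_a = 0, and K(x) is invertible:
    [frame v] is the identity, so v = 0. *)
Lemma flag_param_immersion Z x v : Z *m Z^t* = 1%:M ->
  kato_prod (flag_chart l (frame x)) != 0 -> v != 0 ->
  'D_v (@reim R n \o flag_param Z) x != 0.
Proof.
move=> UZ ku; apply: contra_neq => D0.
have UZ' := mulmx1C UZ.
have dp := smooth_is_mder v openT (flag_param_smooth Z) (I : setT x).
move: dp; set A := \sum_j _ => dp.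
have A0 : A = 0.
  have [_] := is_mder_reim dp; rewrite D0 => E.
  by apply: (@reim_inj R n); rewrite reim0.
have dc : is_mder (fun y => flag_chart l (frame y)) x v 0.
  have -> : (fun y => flag_chart l (frame y)) = fun y => Z^t* *m flag_param Z y *m Z.
    apply/funext => y; rewrite /flag_param !mulmxA UZ' mul1mx -mulmxA UZ' mulmx1 //.
  have := is_mder_mulr Z (is_mder_mull (Z^t*) dp).
  by rewrite A0 mulmx0 mul0mx.
suff fv : frame v = 1%:M by rewrite -(frameK v) fv -frame0 frameK.
apply/eqP; rewrite -subr_eq0; apply/eqP; apply/matrixP => i a.
have dk : is_mder (fun y => kato F a.+1 (flag_chart l (frame y))) x v 0.
  have -> : (fun y => kato F a.+1 (flag_chart l (frame y))) = fun y =>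
    (1%:M - T a.+1) + (T a.+1 - (1%:M - T a.+1)) *m
      horner_mx (flag_chart l (frame y)) (F a.+1).
    by apply/funext => y; exact: kato_affine.
  have := is_mder_add (is_mder_cst (1%:M - T a.+1) x v)
    (is_mder_mull (T a.+1 - (1%:M - T a.+1)) (is_mder_horner0 (F a.+1) dc)).
  by rewrite mulmx0 addr0.
have df := is_mder_mulr (delta_mx a 0 : 'cV[C]_n) (is_mder_frame x v).
have := is_mder_mul dk df; rewrite mul0mx add0r.
have -> : (fun y => kato F a.+1 (flag_chart l (frame y)) *m
   (frame y *m (delta_mx a 0 : 'cV[C]_n))) = fun=> delta_mx a 0.
  by apply/funext => y; rewrite -colE (kato_frame FE (frame_lower y)).
move=> /is_mder_uniq /(_ (is_mder_cst _ x v)) /(congr1 (mulmx (invmx _))).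
move=> /(_ (kato F a.+1 (flag_chart l (frame x)))).
rewrite mulKmx ?kato_prod_neq0 // mulmx0 -colE => /matrixP /(_ i 0).
by rewrite mxE => ->; rewrite !mxE.
Qed.

(** The inverse [psi] of the chart is given by a formula that is continuous on an open set [D] of
    all matrices, not merely of the isospectral ones. The required open set is thus the preimage of
    [V] under [psi] inside [D]. *)
Lemma flag_param_open (D0 : set M) Z (V : set 'rV[R]_m) : Z *m Z^t* = 1%:M ->
  (forall rho, D0 rho -> exists Z' (t : 'S_n), Z' *m Z'^t* = 1%:M /\
     rho = spec_mx Z' (l \o t)) ->
  (forall x, D0 (flag_param Z x)) ->
  open V -> V `<=` [set x | kato_prod (flag_chart l (frame x)) != 0] ->
  exists2 W : set ('M[R]_n * 'M[R]_n),
    open W & flag_param Z @` V = D0 `&` @reim R n @^-1` W.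
Proof.
move=> UZ D0spec D0param oV VU; have UZ' := mulmx1C UZ.
pose E := ('M[R]_n * 'M[R]_n)%type.
pose r (P : E) : M := Z^t* *m unreim P *m Z.
pose D : set E := setT `&` [set P | kato_prod (r P) != 0].
have algT := @continuous_fun_algebra R E _ openT.
have cr (D' : set E) : open D' ->
    mx_in (fun f : E -> R => forall P, D' P -> {for P, continuous f}) r.
  move=> oD'; have alg := @continuous_fun_algebra R E _ oD'.
  apply: (mx_in_mul alg); last exact: (mx_in_cst alg).
  apply: (mx_in_mul alg); first exact: (mx_in_cst alg).
  exact: unreim_continuous.
have oD : open D.
  by apply: open_cplx_neq0; [exact: openT | apply: kato_prod_in algT (cr _ openT)].
have alg := @continuous_fun_algebra R E _ oD.
have cf : mx_in (fun f : E -> R => forall P, D P -> {for P, continuous f})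
    (fun P => frame_of F (r P)).
  move=> i a; apply: (cplx_in_ext alg (f := fun P => invmx (kato F a.+1 (r P)) i a)).
    by move=> P _; rewrite mxE.
  apply: (mx_in_inv alg); first by move=> P [_ /kato_prod_neq0]; exact.
  have ch := mx_in_horner alg (F a.+1) (cr _ oD).
  apply: (mx_in_add alg); apply: (mx_in_mul alg); [exact: (mx_in_cst alg)| |
    exact: (mx_in_cst alg)|exact: ch].
  by apply: (mx_in_sub alg); [exact: (mx_in_cst alg)|exact: ch].
pose psi P := frame_coords (frame_of F (r P)).
have cpsi P : D P -> {for P, continuous psi}.
  move=> DP; apply: continuous_row => j.
  have -> : (fun P => psi P 0 j) = fun P =>
     if ((pr j).2 < (pr j).1)%N then complex.Re (frame_of F (r P) (pr j).1 (pr j).2)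
     else complex.Im (frame_of F (r P) (pr j).2 (pr j).1).
    by apply/funext => Q; rewrite mxE.
  by case: ((pr j).2 < (pr j).1)%N; [apply: (cf _ _).1 | apply: (cf _ _).2].
exists (D `&` psi @^-1` V).
  rewrite openE => P [DP VP]; rewrite /interior; apply: filterI.
    exact: open_nbhs_nbhs.
  exact: (cpsi P DP _ (open_nbhs_nbhs (conj oV VP))).
have rparam x : r (reim (flag_param Z x)) = flag_chart l (frame x).
  by rewrite /r reimK /flag_param !mulmxA UZ' mul1mx -mulmxA UZ' mulmx1.
apply/seteqP; split=> [_ [x Vx <-]|rho [Drho [[_ Du] Vr]]].
  have xu : kato_prod (flag_chart l (frame x)) != 0 := VU _ Vx.
  have kp : kato_prod (r (reim (flag_param Z x))) != 0 by rewrite rparam.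
  have pp : psi (reim (flag_param Z x)) = x.
    by rewrite /psi rparam (frame_of_flag_chart FE (frame_lower x) (kato_prod_neq0 xu)) frameK.
  have Vp : V (psi (reim (flag_param Z x))) by rewrite pp.
  exact: (conj (D0param x) (conj (conj I kp) Vp)).
have [Z' [t [UZ2 rhoE]]] := D0spec _ Drho.
have rE : r (reim rho) = spec_mx (Z^t* *m Z') (l \o t).
  by rewrite /r reimK rhoE /spec_mx adjmxM adjmxK !mulmxA.
have U3 : (Z^t* *m Z') *m (Z^t* *m Z')^t* = 1%:M.
  by rewrite adjmxM adjmxK mulmxA -[Z^t* *m Z' *m _]mulmxA UZ2 mulmx1.
have ku := kato_prod_neq0 Du; rewrite rE in ku.
exists (psi (reim rho)) => //.
rewrite /flag_param /psi frame_coordsK; last first.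
  by rewrite rE; exact: frame_of_lower_unitriangular.
rewrite rE (flag_chart_frame_of FE U3 ku) -rE /r reimK !mulmxA UZ mul1mx.
by rewrite -mulmxA UZ mulmx1.
Qed.

End Parametrization.

Lemma Ck_on_sub {R : realType} {m : nat} {E : normedModType R} (U V : set 'rV[R]_m)
    (f : 'rV[R]_m -> E) k : V `<=` U -> Ck_on k U f -> Ck_on k V f.
Proof.
move=> VU; elim: k f => [|k IH] f /= [cf df]; first by split=> // x /VU /cf.
split=> [x /VU /cf //|j]; have [dj Cj] := df j; split; last exact: IH.
by move=> x /VU; exact: dj.
Qed.

Section ChartExistence.
Context {R : realType} {n0 m : nat}.
Local Notation C := R[i].
Local Notation n := n0.+1.
Variables (rho_d Z0 : 'M[C]_n) (d : 'I_n -> R).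
Hypothesis UZ0 : Z0 *m Z0^t* = 1%:M.
Hypothesis rho_dE : rho_d = spec_mx Z0 d.
Hypothesis d_inj : injective d.
Hypothesis d_ge0 : forall i, 0 <= d i.
Hypothesis d_sum : \sum_i d i = 1.
Hypothesis n2 : (2 <= n)%N.
Hypothesis mE : m = (n ^ 2 - n)%N.

Lemma isospectral_chart p : isospectral_manifold rho_d p ->
  exists phi : 'rV[R]_m -> 'M[C]_n, local_parametrization (isospectral_manifold rho_d) p phi.
Proof.
move=> /(isospectral_spec UZ0 rho_dE) [Z [s [UZ pE]]].
have [pr [idx [pr_neq prK idxK]]] := offdiag_index n2 mE.
pose l := d \o s.
have linj : injective (fun a => (l a)%:C%C) by move=> a b /complexI /d_inj /perm_inj.
have /choice [F FE] : forall k, exists g : {poly C}, forall a, g.[(l a)%:C%C] = (a < k)%N%:R.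
  by move=> k; exact: (interpolation (fun a : 'I_n => (a < k)%N%:R) linj).
have UZ' := mulmx1C UZ.
have Mspec rho : isospectral_manifold rho_d rho ->
    exists Z' (t : 'S_n), Z' *m Z'^t* = 1%:M /\ rho = spec_mx Z' (l \o t).
  move=> /(isospectral_spec UZ0 rho_dE) [Z' [s' [UZ2 ->]]].
  (* The eigenvalues are numbered by [l = d \o s] at the base point, and products of permutations
     act from left to right. *)
  exists Z', (s' * s^-1)%g; split; first exact: UZ2.
  congr spec_mx; apply/funext => a.
  by rewrite /l /= permM permKV.
have Mparam x : isospectral_manifold rho_d (flag_param idx l Z x).
  have lo := frame_lower idx x.
  have ha : (flag_param idx l Z x)^t* = flag_param idx l Z x.
    by rewrite /flag_param !adjmxM adjmxK flag_chart_adj // mulmxA.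
  have hc : char_poly (flag_param idx l Z x) = char_poly rho_d.
    rewrite /flag_param (char_poly_conj _ UZ) (flag_chart_char_poly _ lo) rho_dE (char_poly_spec _ UZ0).
    by rewrite [RHS](reindex_inj (@perm_inj _ s)).
  have [Z' [s' [UZ2 ->]]] := herm_isospectral UZ0 rho_dE ha hc.
  exact: (spec_isospectral UZ0 rho_dE d_ge0 d_sum).
exists (flag_param idx l Z).
exists [set x | kato_prod F (flag_chart l (frame idx x)) != 0]; split.
- split; last by rewrite /= frame0 // flag_chart1 //; exact: (kato_prod_flag_chart1 idx FE).
  rewrite -[X in open X]setTI; apply: open_cplx_neq0; first exact: openT.
  apply: smooth_continuous.
  exact: (kato_prod_in F (smooth_fun_algebra openT) (flag_chart_smooth idx l)).
- by rewrite /flag_param frame0 // flag_chart1 // pE.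
- have H := (smooth_reimP (flag_param idx l Z) openT).2 (flag_param_smooth idx l Z).
  by move=> k; exact: (Ck_on_sub (@subsetT _ _) (H k)).
- by move=> x v /= xu; exact: (flag_param_immersion pr_neq prK FE UZ xu).
- split.
  move=> x y /set_mem xu /set_mem yu E.
  have rparam z : Z^t* *m flag_param idx l Z z *m Z = flag_chart l (frame idx z).
    by rewrite /flag_param !mulmxA UZ' mul1mx -mulmxA UZ' mulmx1.
  rewrite -(frameK pr_neq prK x) -(frameK pr_neq prK y).
  rewrite -(frame_of_flag_chart FE (frame_lower idx x) (kato_prod_neq0 xu)).
  rewrite -(frame_of_flag_chart FE (frame_lower idx y) (kato_prod_neq0 yu)).
  by rewrite -!rparam E.
  move=> V oV VU; exact: (flag_param_open pr_neq prK idxK FE UZ Mspec Mparam oV VU).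
Qed.

End ChartExistence.

(** * Tangent space and Hessian *)

Section PowerTrace.
Context {R : realType} {n0 : nat} {V : normedModType R}.
Local Notation C := R[i].
Local Notation n := n0.+1.

(** The derivative of a power is a sum of words F^i X F^j. Cyclicity of the trace makes all of them
    equal once multiplied by a matrix commuting with [F x]. An arbitrary such [A] is allowed because
    the induction replaces [A] by [F x *m A]. *)
Lemma is_mder_exp (F : V -> 'M[C]_n) x v X k : is_mder F x v X ->
  exists Y, is_mder (fun y => F y ^+ k.+1) x v Y /\
    forall A, A *m F x = F x *m A -> \tr (A *m Y) = k.+1%:R * \tr (A *m F x ^+ k *m X).
Proof.
move=> dF; elim: k => [|k [Y [dY tY]]].
  exists X; split; first exact: dF.
  by move=> A _; rewrite mul1r expr0 [A *m 1]mulmx1.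
exists (Y *m F x + F x ^+ k.+1 *m X); split.
  have -> : (fun y => F y ^+ k.+2) = fun y => F y ^+ k.+1 *m F y.
    by apply/funext => y; rewrite exprSr.
  exact: is_mder_mul.
move=> A AF; rewrite mulmxDr linearD /= [A *m (Y *m _)]mulmxA mxtrace_mulC !mulmxA.
have FA : (F x *m A) *m F x = F x *m (F x *m A) by rewrite -mulmxA AF.
rewrite (tY _ FA) -AF -[A *m F x *m _]mulmxA -[F x *m F x ^+ k]/(F x * F x ^+ k) -exprS.
by rewrite -[k.+2]addn1 natrD mulrDl mul1r.
Qed.

End PowerTrace.

Lemma horner_mx_sum {F : fieldType} {n0 : nat} (A : 'M[F]_n0.+1) (g : {poly F}) :
  horner_mx A g = \sum_(i < size g) g`_i *: A ^+ i.
Proof.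
rewrite -{1}[g]coefK poly_def raddf_sum; apply: eq_bigr => i _.
by rewrite /= horner_mxZ rmorphXn /= horner_mx_X.
Qed.

Section SymmetricSums.
Context {R : realType} {n : nat}.

Lemma sum_lt_symmetric (h : 'I_n -> 'I_n -> R) : (forall a b, h a b = h b a) ->
  \sum_(a < n) \sum_(b < n | (a < b)%N) h a b = \sum_(a < n) \sum_(b < n | (b < a)%N) h a b.
Proof.
move=> hs; rewrite (exchange_big_dep predT) //=; apply: eq_bigr => a _.
by apply: eq_bigr => b _; rewrite hs.
Qed.

Lemma sum_neq_split (h : 'I_n -> 'I_n -> R) :
  \sum_a \sum_(b | a != b) h a b =
  \sum_(a < n) \sum_(b < n | (b < a)%N) h a b + \sum_(a < n) \sum_(b < n | (a < b)%N) h a b.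
Proof.
rewrite -big_split; apply: eq_bigr => a _ /=.
rewrite (bigID (fun b : 'I_n => (b < a)%N)) /=; congr (_ + _); apply: eq_bigl => b.
  by case: ltnP => ba; rewrite ?andbF ?andbT // -(inj_eq val_inj) /= neq_ltn ba orbT.
by rewrite -leqNgt -(inj_eq val_inj) /= ltn_neqAle.
Qed.

End SymmetricSums.

Section Hermitian.
Context {R : realType} {n m : nat}.
Local Notation C := R[i].
Local Notation Re := (@complex.Re R).
Local Notation Im := (@complex.Im R).
Variables (pr : 'I_m -> 'I_n * 'I_n) (idx : 'I_n * 'I_n -> 'I_m).
Hypothesis pr_neq : forall j, (pr j).1 != (pr j).2.
Hypothesis prK : cancel pr idx.
Hypothesis idxK : forall p, p.1 != p.2 -> pr (idx p) = p.

Lemma sum_pr (h : 'I_n -> 'I_n -> R) :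
  \sum_k h (pr k).1 (pr k).2 = \sum_a \sum_(b | a != b) h a b.
Proof.
rewrite pair_big_dep /=; rewrite [RHS](reindex_onto pr idx) /=; last first.
  by move=> p; exact: idxK.
by apply: eq_bigl => k; rewrite prK eqxx pr_neq.
Qed.

Definition herm_coords (Y : 'M[C]_n) (k : 'I_m) : R :=
  if ((pr k).2 < (pr k).1)%N then Re (Y (pr k).1 (pr k).2) else Im (Y (pr k).2 (pr k).1).

Lemma herm_coords_sum (I : Type) (r : seq I) (c : I -> R) (Y : I -> 'M[C]_n) k :
  herm_coords (\sum_(i <- r) (c i)%:C%C *: Y i) k = \sum_(i <- r) c i * herm_coords (Y i) k.
Proof.
rewrite /herm_coords; case: ifP => _; rewrite summxE ?Re_sum ?Im_sum;
  by apply: eq_bigr => i _; rewrite mxE ?cReM ?cImM /= mul0r ?subr0 ?addr0.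
Qed.

Lemma herm_part (Y : 'M[C]_n) : Y^t* = Y -> forall a b,
  Re (Y a b) = Re (Y b a) /\ Im (Y a b) = - Im (Y b a).
Proof. move=> hY a b; have E : Y a b = Num.conj (Y b a) by rewrite -adjE hY.
by rewrite E cRe_conj cIm_conj. Qed.

(** By hermiticity, Re (Y_ab W_ba) is the product of the real parts plus that of the imaginary
    parts, the same for (a, b) and (b, a); hence the factor 2. As [c] is symmetric, both coordinates
    of an entry get the same weight and the form is diagonal. *)
Lemma herm_pairing (c : 'I_n -> 'I_n -> R) (Y W : 'M[C]_n) :
  (forall a b, c a b = c b a) -> Y^t* = Y -> W^t* = W ->
  \sum_a \sum_(b | a != b) c a b * Re (Y a b * W b a) =
  \sum_k 2 * c (pr k).1 (pr k).2 * herm_coords Y k * herm_coords W k.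
Proof.
move=> cs /herm_part hY /herm_part hW.
pose r a b := c a b * (Re (Y a b) * Re (W a b)).
pose i a b := c a b * (Im (Y b a) * Im (W b a)).
have rs a b : r a b = r b a by rewrite /r cs (hY a b).1 (hW a b).1.
have is_ a b : i a b = i b a.
  by rewrite /i cs (hY a b).2 (hW a b).2 mulrNN.
transitivity (\sum_a \sum_(b | a != b) (r a b + i a b)).
  apply: eq_bigr => a _; apply: eq_bigr => b _; rewrite /r /i -mulrDr; congr (_ * _).
  by rewrite cReM (hW b a).1 (hY a b).2 mulNr opprK.
transitivity (\sum_(a < n) \sum_(b < n | a != b) 2 * (if (b < a)%N then r a b else i a b)).
  rewrite !sum_neq_split; under eq_bigr do rewrite big_split.
  rewrite big_split /=; under [X in _ + _ + X = _]eq_bigr do rewrite big_split.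
  rewrite big_split /= (sum_lt_symmetric rs) -(sum_lt_symmetric is_).
  have -> : \sum_(a < n) \sum_(b < n | (b < a)%N) 2 * (if (b < a)%N then r a b else i a b) =
     2 * \sum_(a < n) \sum_(b < n | (b < a)%N) r a b.
    rewrite mulr_sumr; apply: eq_bigr => a _; rewrite mulr_sumr.
    by apply: eq_bigr => b ->.
  have -> : \sum_(a < n) \sum_(b < n | (a < b)%N) 2 * (if (b < a)%N then r a b else i a b) =
     2 * \sum_(a < n) \sum_(b < n | (a < b)%N) i a b.
    rewrite mulr_sumr; apply: eq_bigr => a _; rewrite mulr_sumr.
    by apply: eq_bigr => b ab; rewrite ltnNge (ltnW ab).
  by ring.
rewrite -(sum_pr (fun a b => 2 * (if (b < a)%N then r a b else i a b))).
apply: eq_bigr => k _; rewrite /herm_coords /r /i; by case: ifP => _; ring.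
Qed.

Lemma herm_coords_eq0 (Y : 'M[C]_n) : Y^t* = Y -> (forall k, herm_coords Y k = 0) ->
  forall a b, a != b -> Y a b = 0.
Proof.
move=> hY c0; have H (a b : 'I_n) : (b < a)%N -> Y a b = 0.
  move=> ba; have ab : a != b by rewrite -(inj_eq val_inj) /= neq_ltn ba orbT.
  have := c0 (idx (a, b)); have := c0 (idx (b, a)).
  rewrite /herm_coords !idxK //= 1?eq_sym // ba ltnNge (ltnW ba) /= => i0 r0.
  exact: complex_eqP.
move=> a b; rewrite -(inj_eq val_inj) /= neq_ltn => /orP[ab|/H //].
by rewrite -hY adjE H // rmorph0.
Qed.

End Hermitian.

Lemma horner_mx_comm {F : fieldType} {n0 : nat} (A : 'M[F]_n0.+1) g :
  horner_mx A g *m A = A *m horner_mx A g.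
Proof.
have := rmorphM (horner_mx A) g 'X.
by rewrite mulrC rmorphM /= horner_mx_X => /esym.
Qed.

(** * Gradient and Hessian of the overlap in an arbitrary chart *)

Section LocalGeometry.
Context {R : realType} {n0 m : nat}.
Local Notation C := R[i].
Local Notation n := n0.+1.
Local Notation Re := (@complex.Re R).
Variables (pr : 'I_m -> 'I_n * 'I_n) (idx : 'I_n * 'I_n -> 'I_m).
Hypothesis pr_neq : forall j, (pr j).1 != (pr j).2.
Hypothesis prK : cancel pr idx.
Hypothesis idxK : forall p, p.1 != p.2 -> pr (idx p) = p.
Variables (rho_d Z0 : 'M[C]_n) (d : 'I_n -> R).
Hypothesis UZ0 : Z0 *m Z0^t* = 1%:M.
Hypothesis rho_dE : rho_d = spec_mx Z0 d.
Hypothesis d_inj : injective d.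
Local Notation M := (isospectral_manifold rho_d).
Local Notation J := (overlap rho_d).

(** Reduces a chart to what the differential computations use. Values in M come from the openness
    condition applied to [U] itself; the immersion condition at 0 becomes linear independence of the
    partial derivatives over the reals. *)
Lemma local_parametrization_data p (phi : 'rV[R]_m -> 'M[C]_n) :
  local_parametrization M p phi -> exists U : set 'rV[R]_m,
    [/\ open U /\ U 0, phi 0 = p, mx_in (@smooth_on R m R U) phi,
        forall x, U x -> M (phi x) &
        forall v : 'rV[R]_m, \sum_j (v 0 j)%:C%C *: mpartial j phi 0 = 0 -> v = 0].
Proof.
move=> [U [[oU U0] p0 Sphi im [_ op]]]; exists U.
have Sm := (smooth_reimP phi oU).1 Sphi.
split=> //.
- have [W _ WE] := op U oU (@subset_refl _ U).
  move=> x Ux; have : (phi @` U) (phi x) by exists x.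
  by rewrite WE => -[].
- move=> v Xv; apply/eqP; apply/negPn/negP => v0.
  have := im 0 v U0 v0.
  have [_ ->] := is_mder_reim (smooth_is_mder v oU Sm U0).
  by rewrite Xv reim0 eqxx.
Qed.

Variables (Z : 'M[C]_n) (s : 'S_n).
Hypothesis UZ : Z *m Z^t* = 1%:M.
Local Notation l := (d \o s).
Variables (phi : 'rV[R]_m -> 'M[C]_n) (U : set 'rV[R]_m).
Hypothesis oU : open U.
Hypothesis U0 : U 0.
Hypothesis phi0 : phi 0 = spec_mx Z l.
Hypothesis Sphi : mx_in (@smooth_on R m R U) phi.
Hypothesis Mphi : forall x, U x -> M (phi x).
Hypothesis immersion :
  forall v : 'rV[R]_m, \sum_j (v 0 j)%:C%C *: mpartial j phi 0 = 0 -> v = 0.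

Let UZ' : Z^t* *m Z = 1%:M. Proof. exact: mulmx1C. Qed.

Lemma trace_power_isospectral rho k : M rho -> \tr (rho ^+ k) = \sum_a ((d a)%:C%C) ^+ k.
Proof.
move=> /(isospectral_spec UZ0 rho_dE) [Z' [t [UZ2 ->]]].
have := horner_spec_mx (d \o t) 'X^k UZ2.
rewrite rmorphXn /= horner_mx_X => ->.
rewrite mxtrace_mulC mulmxA (mulmx1C UZ2) mul1mx [RHS](reindex_inj (@perm_inj _ t)).
by apply: eq_bigr => a _; rewrite !mxE eqxx mulr1n hornerXn.
Qed.

Lemma tangent_trace x j g : U x ->
  \tr (horner_mx (phi x) g *m mpartial j phi x) = 0.
Proof.
move=> Ux; have dphi := mpartial_is_mder j Sphi Ux.
rewrite horner_mx_sum mulmx_suml raddf_sum big1 // => k _ /=.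
rewrite -scalemxAl linearZ /=.
(* The coefficient of degree k uses the constancy of the next power: tr (phi^(k+1)) has derivative
   (k+1) tr (phi^k d_j phi), and k + 1 is invertible. *)
have [Y [dY tY]] := is_mder_exp k dphi.
have Y0 : \tr Y = 0.
  apply: (is_cder_uniq (is_cder_tr dY)).
  apply: (is_cder_open_eq oU Ux _ (is_cder_cst (\sum_a ((d a)%:C%C) ^+ k.+1) _ _)).
  by move=> y Uy; rewrite trace_power_isospectral //; exact: Mphi.
have := tY 1%:M (etrans (mul1mx _) (esym (mulmx1 _))).
rewrite !mul1mx Y0 => /esym/eqP; rewrite mulf_eq0 pnatr_eq0 /= => /eqP ->.
by rewrite mulr0.
Qed.

Lemma mul_conj (A B : 'M[C]_n) :
  Z *m A *m Z^t* *m (Z *m B *m Z^t*) = Z *m (A *m B) *m Z^t*.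
Proof. by rewrite -!mulmxA; do 2!congr (_ *m _); rewrite [Z^t* *m _]mulmxA UZ' mul1mx. Qed.

Lemma tr_conj (A B : 'M[C]_n) :
  \tr (Z *m A *m Z^t* *m (Z *m B *m Z^t*)) = \tr (A *m B).
Proof. by rewrite mul_conj mxtrace_mulC [Z^t* *m _]mulmxA UZ' mul1mx. Qed.

Lemma conj_mx_inj (A B : 'M[C]_n) : Z *m A *m Z^t* = Z *m B *m Z^t* -> A = B.
Proof.
move=> /(congr1 (fun X => Z^t* *m X *m Z)).
by rewrite !mulmxA UZ' !mul1mx -!mulmxA UZ' !mulmx1.
Qed.

Lemma tangent_herm j : (mpartial j phi 0)^t* = mpartial j phi 0.
Proof.
have dphi := mpartial_is_mder j Sphi U0.
apply: (is_mder_uniq (is_mder_adj dphi)).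
apply: (is_mder_open_eq oU U0 _ dphi) => y /Mphi [[/herm_adjmxP hy _ _] _].
by rewrite hy.
Qed.

Definition tangent j : 'M[C]_n := Z^t* *m mpartial j phi 0 *m Z.

Lemma tangentE j : mpartial j phi 0 = Z *m tangent j *m Z^t*.
Proof. by rewrite /tangent !mulmxA UZ mul1mx -mulmxA UZ mulmx1. Qed.

Lemma tangent_adj j : (tangent j)^t* = tangent j.
Proof. by rewrite /tangent !adjmxM adjmxK tangent_herm mulmxA. Qed.

Lemma tangent_diag j a : tangent j a a = 0.
Proof.
have linj : injective (fun a => (l a)%:C%C) by move=> x y /complexI /d_inj /perm_inj.
(* With this [g], g(p) is the projection on the a-th eigenvector, and the trace isolates the a-th
   diagonal entry. *)
have [g gE] := interpolation (fun b => (b == a)%:R : C) linj.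
have := tangent_trace j g U0; rewrite phi0 (horner_spec_mx _ _ UZ) tangentE tr_conj.
move: (tangent j) => Y; rewrite /mxtrace (bigD1 a) //= big1 ?addr0 => [|b ba].
  by rewrite mul_diag_mx !mxE gE eqxx mul1r.
by rewrite mul_diag_mx mxE [X in X * _]mxE gE (negPf ba) mul0r.
Qed.

Definition tangent_coords : 'M[R]_m := \matrix_(j, k) herm_coords pr (tangent j) k.

(** This is the dimension count: the rows are independent by the immersion condition, because a
    zero-diagonal Hermitian matrix is determined by its m coordinates; and the matrix is square. *)
Lemma tangent_coords_unit : tangent_coords \in unitmx.
Proof.
rewrite unitmxE unitfE; apply/det0P => -[v /eqP v0 vN]; apply: v0.
apply: immersion; pose Y := \sum_j (v 0 j)%:C%C *: tangent j.
have hY : Y^t* = Y.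
  by rewrite /Y adjmx_sum; apply: eq_bigr => j _; rewrite adjmxZ_real tangent_adj.
have cY k : herm_coords pr Y k = 0.
  rewrite herm_coords_sum; have := congr1 (fun A : 'rV_m => A 0 k) vN; rewrite !mxE => E.
  by rewrite -[RHS]E; apply: eq_bigr => j _; rewrite mxE.
have Y0 : Y = 0.
  apply/matrixP => a b; rewrite [RHS]mxE; have [->|ab] := eqVneq a b.
    by rewrite summxE big1 // => j _; rewrite mxE tangent_diag mulr0.
  exact: (herm_coords_eq0 idxK hY cY).
have -> : \sum_j (v 0 j)%:C%C *: mpartial j phi 0 = Z *m Y *m Z^t*.
  rewrite mulmx_sumr mulmx_suml; apply: eq_bigr => j _.
  by rewrite -scalemxAr -scalemxAl tangentE.
by rewrite Y0 mulmx0 mul0mx.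
Qed.

Lemma re_trace_offdiag (A B : 'M[C]_n) : (forall a, B a a = 0) ->
  Re (\tr (A *m B)) = \sum_a \sum_(b | a != b) Re (A a b * B b a).
Proof.
move=> B0; rewrite Re_sum; apply: eq_bigr => a _; rewrite mxE Re_sum.
rewrite (bigD1 a) //= B0 mulr0 add0r; apply: eq_bigl => b.
by rewrite eq_sym.
Qed.

Lemma partial_overlap x j : U x ->
  partial j (J \o phi) x = Re (\tr (mpartial j phi x *m rho_d)).
Proof.
move=> Ux; have dphi := mpartial_is_mder j Sphi Ux.
by have [[_ <-] _] := is_cder_tr (is_mder_mulr rho_d dphi).
Qed.

Lemma partial_overlap0 j : partial j (J \o phi) 0 =
  2 * \sum_k tangent_coords j k * herm_coords pr (Z^t* *m rho_d *m Z) k.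
Proof.
have -> : partial j (J \o phi) 0 = Re (\tr (Z^t* *m rho_d *m Z *m tangent j)).
  rewrite partial_overlap // tangentE; move: (tangent j) => Y.
  have {1}-> : rho_d = Z *m (Z^t* *m rho_d *m Z) *m Z^t*.
    by rewrite !mulmxA UZ mul1mx -mulmxA UZ mulmx1.
  by rewrite tr_conj mxtrace_mulC.
rewrite (re_trace_offdiag _ (tangent_diag j)).
have hD : (Z^t* *m rho_d *m Z)^t* = Z^t* *m rho_d *m Z.
  by rewrite !adjmxM adjmxK rho_dE spec_mx_adj mulmxA.
have := herm_pairing pr_neq prK idxK (c := fun _ _ => 1) (fun _ _ => erefl) hD (tangent_adj j).
under eq_bigr do under eq_bigr do rewrite mul1r.
move=> ->; rewrite mulr_sumr; apply: eq_bigr => k _.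
by rewrite mxE; ring.
Qed.

(** The gradient is twice the invertible matrix [tangent_coords] applied to the off-diagonal
    coordinates of [rho_d] in the eigenbasis [Z]. *)
Lemma partial_overlap_eq0P : (forall j, partial j (J \o phi) 0 = 0) <->
  (forall a b, a != b -> (Z^t* *m rho_d *m Z) a b = 0).
Proof.
have hD : (Z^t* *m rho_d *m Z)^t* = Z^t* *m rho_d *m Z.
  by rewrite !adjmxM adjmxK rho_dE spec_mx_adj mulmxA.
split=> [H|H j].
  apply: (herm_coords_eq0 idxK hD) => k.
  pose h : 'cV[R]_m := \col_k herm_coords pr (Z^t* *m rho_d *m Z) k.
  suff h0 : h = 0 by have := congr1 (fun A : 'cV_m => A k 0) h0; rewrite !mxE.
  rewrite -(mulKmx tangent_coords_unit h) (_ : _ *m h = 0) ?mulmx0 //.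
  apply/colP => j; have := H j; rewrite partial_overlap0 => /eqP.
  rewrite mulf_eq0 pnatr_eq0 /= => /eqP E; rewrite [RHS]mxE -E mxE.
  by apply: eq_bigr => i _; rewrite [h _ _]mxE.
rewrite partial_overlap0 big1 ?mulr0 // => k _.
suff -> : herm_coords pr (Z^t* *m rho_d *m Z) k = 0 by rewrite mulr0.
rewrite /herm_coords; have pk := pr_neq k.
by case: ifP => _; rewrite H // 1?eq_sym.
Qed.

(** The divided difference, at [l a] and [l b], of a polynomial with values [d a] at [l a], as in
    the Daletskii-Krein formula for the derivative of a matrix function. *)
Definition quotient_coef a b : R := (d a - d b) / (l a - l b).

Lemma quotient_coefC a b : quotient_coef a b = quotient_coef b a.
Proof. by rewrite /quotient_coef -opprB -[l a - l b]opprB invrN mulrNN. Qed.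

(* On M one has tr (g(phi) d_j phi) = 0 for every polynomial g.  With
   g(p) = rho_d, differentiating along i expresses the second derivative of J
   through the first derivative of g(phi), which is read off the commutation of
   g(phi) and phi: no second derivative of phi is involved. *)
Lemma hessian_overlap : Z^t* *m rho_d *m Z = real_diag d ->
  hessian (J \o phi) 0 = - (tangent_coords *m
    diag_mx (\row_k (2 * quotient_coef (pr k).1 (pr k).2)) *m tangent_coords^T).
Proof.
move=> DE; apply/matrixP => i j; rewrite [LHS]mxE.
have rhoE : rho_d = Z *m real_diag d *m Z^t*.
  by rewrite -DE !mulmxA UZ mul1mx -mulmxA UZ mulmx1.
have linj : injective (fun a => (l a)%:C%C) by move=> x y /complexI /d_inj /perm_inj.
have [g gE] := interpolation (fun a => (d a)%:C%C) linj.
have gp : horner_mx (phi 0) g = rho_d.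
  rewrite phi0 (horner_spec_mx _ _ UZ) rhoE; congr (_ *m diag_mx _ *m _).
  by apply/rowP => a; rewrite !mxE gE.
have dphi := mpartial_is_mder i Sphi U0.
have dphij := mpartial_is_mder i (mpartial_smooth j Sphi) U0.
set X2 := mpartial i _ 0 in dphij.
have [B dB] := is_mder_horner g dphi.
have HE : partial i (partial j (J \o phi)) 0 = Re (\tr (X2 *m rho_d)).
  have [dr _] := is_cder_tr (is_mder_mulr rho_d dphij).
  have [_] := is_derive_open_eq oU U0 (fun x Ux => esym (partial_overlap j Ux)) dr.
  by [].
(* The identity tr (g(phi) d_j phi) = 0 holds on all of [U], so it can be differentiated along i. *)
have E1 : \tr (B *m mpartial j phi 0) + \tr (rho_d *m X2) = 0.
  have := is_cder_tr (is_mder_mul dB dphij); rewrite gp linearD /= => H.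
  apply: (is_cder_uniq H); apply: (is_cder_open_eq oU U0 _ (is_cder_cst 0 _ _)).
  by move=> y Uy; rewrite tangent_trace.
(* The derivative along i of g(phi) phi = phi g(phi). *)
have E2 : B *m phi 0 + rho_d *m mpartial i phi 0 =
          mpartial i phi 0 *m rho_d + phi 0 *m B.
  have H1 := is_mder_mul dB dphi; have H2 := is_mder_mul dphi dB.
  rewrite gp in H1 H2; apply: (is_mder_uniq H1).
  have -> // : (fun y => horner_mx (phi y) g *m phi y) = fun y => phi y *m horner_mx (phi y) g.
  by apply/funext => y; exact: horner_mx_comm.
have [B' BE] : exists B', B = Z *m B' *m Z^t*.
  by exists (Z^t* *m B *m Z); rewrite !mulmxA UZ mul1mx -mulmxA UZ mulmx1.
have E3 : B' *m real_diag l + real_diag d *m tangent i =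
          tangent i *m real_diag d + real_diag l *m B'.
  move: E2; rewrite BE rhoE phi0 /spec_mx tangentE; move: (tangent i) => Y.
  by rewrite !mul_conj -!mulmxDl -!mulmxDr => /conj_mx_inj.
(* The entry (a, b) of the commutation relation is divided by the nonzero [l a - l b]. The diagonal
   of [B'] stays undetermined, but the trace against [tangent j] does not see it, that matrix having
   zero diagonal. *)
have E4 a b : a != b -> B' a b = (quotient_coef a b)%:C%C * tangent i a b.
  move=> ab; move: E3; move: (tangent i) => Y /(congr1 (fun A : 'M[C]_n => A a b)).
  rewrite [LHS]mxE [RHS]mxE !mul_diag_mx !mul_mx_diag !mxE => E.
  have lab : (l a)%:C%C - (l b)%:C%C != 0 :> C.
    by rewrite subr_eq0; apply: contra_neq ab => /linj.
  apply: (mulfI lab); rewrite /quotient_coef rmorphM fmorphV !rmorphB /=.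
  rewrite [RHS]mulrA [X in _ = X * _]mulrC divfK //.
  apply/eqP; rewrite -subr_eq0; apply/eqP; move: E => /eqP; rewrite -subr_eq0 => /eqP E.
  by rewrite -[RHS]oppr0 -[in RHS]E /=; ring.
rewrite HE.
have -> : \tr (X2 *m rho_d) = - \tr (B' *m tangent j).
  apply/eqP; rewrite -addr_eq0 mxtrace_mulC addrC; apply/eqP; rewrite -[RHS]E1; congr (_ + _).
  by rewrite BE tangentE tr_conj.
rewrite cReN (re_trace_offdiag _ (tangent_diag j)) [RHS]mxE; congr (- _).
transitivity (\sum_a \sum_(b | a != b) quotient_coef a b * Re (tangent i a b * tangent j b a)).
  apply: eq_bigr => a _; apply: eq_bigr => b ab; rewrite E4 // -mulrA cReM /= mul0r subr0 //.
rewrite (herm_pairing pr_neq prK idxK quotient_coefC (tangent_adj i) (tangent_adj j)).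
have NE i' k : tangent_coords i' k = herm_coords pr (tangent i') k by rewrite mxE.
rewrite mxE; apply: eq_bigr => k _; rewrite mul_mx_diag [X in _ = X * _]mxE.
rewrite [X in _ = _ * X * _]mxE [X in _ = _ * X]mxE !NE.
by congr (_ * _); rewrite mulrC.
Qed.

End LocalGeometry.

(** * Signatures and rearrangements *)

Lemma card_eq_finset (T : finType) (A : {set T}) : [set x | x \in A] #= `I_#|A|.
Proof.
have -> : [set x | x \in A] = (@enum_val T (mem A)) @` [set: 'I_#|A|].
  apply/seteqP; split=> [x /= xA|x /= [i _ <-]]; last exact: enum_valP.
  by exists (enum_rank_in xA x) => //; rewrite enum_rankK_in.
apply: card_eq_trans (card_esym card_II).
by apply: inj_card_eq => i j _ _; exact: enum_val_inj.
Qed.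

Section Signature.
Context {R : realType} {m : nat}.
Local Notation C := R[i].

(** By the spectral theorem for the complexified matrix, a form without positive eigenvalues would
    be nonpositive everywhere. The eigenvalue found is real, and it descends to [H] as a root of the
    real characteristic polynomial. *)
Lemma symmetric_pos_eigenvalue (H : 'M[R]_m) (v : 'rV[R]_m) : H^T = H ->
  0 < (v *m H *m v^T) 0 0 -> exists2 a, 0 < a & eigenvalue H a.
Proof.
move=> HT vHv; pose Hc : 'M[C]_m := map_mx (real_complex R) H.
have hH : Hc^t* = Hc.
  by apply/matrixP => i j; rewrite adjE !mxE conj_real -[in LHS]HT mxE.
have [Z [e [UZ HE]]] := spectral_decomposition hH.
have [/existsP [a ea]|/existsPn en] := boolP [exists a, 0 < e a].
  exists (e a) => //; rewrite eigenvalue_root_char.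
  rewrite -(fmorph_root (real_complex R)) map_char_poly -/Hc HE char_poly_spec //.
  rewrite /root horner_prod (bigD1 a) //= hornerXsubC.
  by rewrite -[X in X - _]/((e a)%:C%C) subrr mul0r.
have : (real_complex R ((v *m H *m v^T) 0 0)) <= 0.
  pose vc : 'rV[C]_m := map_mx (real_complex R) v.
  have vcT : map_mx (real_complex R) v^T = vc^t*.
    by apply/matrixP => i j; rewrite adjE !mxE conj_real.
  have -> : real_complex R ((v *m H *m v^T) 0 0) = (vc *m Hc *m vc^t*) 0 0.
    by rewrite -vcT /vc /Hc -!map_mxM [RHS]mxE.
  rewrite HE /spec_mx; have -> : vc *m (Z *m real_diag e *m Z^t*) *m vc^t* =
     (vc *m Z) *m real_diag e *m (vc *m Z)^t* by rewrite adjmxM !mulmxA.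
  move: (vc *m Z) => w; rewrite mxE sumr_le0 // => a _.
  rewrite mul_mx_diag mxE adjE mxE mulrAC -normCK mulr_ge0_le0 ?exprn_ge0 //.
  by rewrite lecR leNgt; exact: en.
by rewrite lecR leNgt vHv.
Qed.

Lemma symmetric_neg_eigenvalue (H : 'M[R]_m) (v : 'rV[R]_m) : H^T = H ->
  (v *m H *m v^T) 0 0 < 0 -> exists2 a, a < 0 & eigenvalue H a.
Proof.
move=> HT vHv; have [||a a0] := @symmetric_pos_eigenvalue (- H) v.
- by rewrite linearN /= HT.
- by rewrite mulmxN mulNmx mxE oppr_gt0.
move=> /eigenvalueP [u uH u0]; exists (- a); first by rewrite oppr_lt0.
by apply/eigenvalueP; exists u => //; rewrite scaleNr -uH mulmxN opprK.
Qed.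

Variables (N : 'M[R]_m) (w : 'rV[R]_m).
Hypothesis Nu : N \in unitmx.
Local Notation H := (- (N *m diag_mx w *m N^T)).

Lemma congruent_diag_unit : (forall k, w 0 k != 0) -> H \in unitmx.
Proof.
move=> w0; rewrite -scaleN1r unitmxZ ?unitrN1 // !unitmx_mul unitmx_tr Nu !andbT /=.
by rewrite unitmxE det_diag unitfE; apply/prodf_neq0 => k _; exact: w0.
Qed.

Lemma congruent_diag_sym : H^T = H.
Proof. by rewrite linearN /= !trmx_mul trmxK tr_diag_mx mulmxA. Qed.

(** The vector is chosen with v N = e_k, so that the form reads off one diagonal coefficient; with
    the two lemmas above, this is the part of the law of inertia used for saddles. *)
Lemma congruent_diag_form k : let v := delta_mx 0 k *m invmx N : 'rV[R]_m in
  (v *m H *m v^T) 0 0 = - w 0 k.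
Proof.
move=> v; rewrite mulmxN mulNmx mxE; congr (- _).
have E (u : 'rV[R]_m) :
    u *m (N *m diag_mx w *m N^T) *m u^T = (u *m N) *m diag_mx w *m (u *m N)^T.
  by rewrite [in RHS]trmx_mul !mulmxA.
rewrite E /v mulmxKV // mul_mx_diag mxE (bigD1 k) //= big1 => [|i ik].
  by rewrite !mxE !eqxx mul1r mulr1 addr0.
by rewrite !mxE (negPf ik) /= mul0r mul0r.
Qed.

Lemma congruent_diag_pos k : w 0 k < 0 -> exists2 a, 0 < a & eigenvalue H a.
Proof.
move=> wk; apply: (symmetric_pos_eigenvalue (v := delta_mx 0 k *m invmx N) congruent_diag_sym).
by rewrite congruent_diag_form oppr_gt0.
Qed.

Lemma congruent_diag_neg k : 0 < w 0 k -> exists2 a, a < 0 & eigenvalue H a.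
Proof.
move=> wk; apply: (symmetric_neg_eigenvalue (v := delta_mx 0 k *m invmx N) congruent_diag_sym).
by rewrite congruent_diag_form oppr_lt0.
Qed.

End Signature.

Section Permutations.
Context {n : nat}.
Implicit Type s : 'S_n.

(** The number of elements below [k] determines [k], and a permutation preserving and reflecting the
    order preserves this number. *)
Lemma increasing_perm_id s : (forall a b : 'I_n, (a < b)%N -> (s a < s b)%N) -> s = 1%g.
Proof.
move=> si; pose r (k : 'I_n) := #|[set c : 'I_n | (c < k)%N]%SET|.
have ri (a b : 'I_n) : (a < b)%N -> (r a < r b)%N.
  move=> ab; apply: proper_card; apply/properP; split.
    by apply/fintype.subsetP => c; rewrite !inE => /ltn_trans; exact.
  by exists a; rewrite !inE ?ltnn.
have rinj (a b : 'I_n) : r a = r b -> a = b.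
  move=> E; apply/val_inj; case: (ltngtP a b) => // /ri; by rewrite E ltnn.
have sE (a b : 'I_n) : (s a < s b)%N = (a < b)%N.
  case: (ltngtP a b) => [/si ->|/si ba|/val_inj ->] //; last by rewrite ltnn.
  by apply/negbTE; rewrite -leqNgt ltnW.
apply/permP => a; rewrite perm1; apply: rinj.
rewrite /r -(card_preimset [set c : 'I_n | (c < s a)%N]%SET (@perm_inj _ s)).
by apply: eq_card => b; rewrite !inE sE.
Qed.

Lemma inversion_of_perm s : s != 1%g ->
  exists a b : 'I_n, (a < b)%N /\ (s b < s a)%N.
Proof.
move=> s1; apply: contrapT => H; case/eqP: s1; apply: increasing_perm_id => a b ab.
rewrite ltnNge leq_eqVlt; apply/negP => /orP[/eqP/val_inj/perm_inj E|ba].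
  by rewrite E ltnn in ab.
by apply: H; exists a, b.
Qed.

Definition rev_perm : 'S_n := perm (@rev_ord_inj n).

Lemma noninversion_of_perm s : s != rev_perm ->
  exists a b : 'I_n, (a < b)%N /\ (s a < s b)%N.
Proof.
move=> sr; have [|a [b [ab]]] := @inversion_of_perm (s * rev_perm)%g.
  apply: contra_neq sr => E; apply/permP => a.
  have := congr1 (fun t : 'S_n => rev_ord (t a)) E.
  by rewrite !permE /= permE rev_ordK.
rewrite !permE /= !permE /= => ba; exists a, b; split=> //.
by move: ba; have := ltn_ord (s a); have := ltn_ord (s b); lia.
Qed.

End Permutations.

(** * Rearrangement inequalities and the assignment problem *)

Section Rearrangement.
Context {R : realType} {n : nat}.
Variable d : 'I_n -> R.
Hypothesis d_incr : forall i j : 'I_n, (i < j)%N -> d i < d j.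

Let d_le (i j : 'I_n) : (i <= j)%N -> d i <= d j.
Proof. by rewrite leq_eqVlt => /orP[/eqP/val_inj -> //|/d_incr/ltW]. Qed.

Definition perm_value (s : 'S_n) : R := \sum_a d a * d (s a).

(** The difference of the two values is the product of [d (s b) - d (s a)] and [d b - d a], both
    positive. This gives strictness at the minimum. *)
Lemma perm_value_swap (s : 'S_n) (a b : 'I_n) : (a < b)%N -> (s a < s b)%N ->
  perm_value (tperm a b * s)%g < perm_value s.
Proof.
move=> ab sab; rewrite /perm_value.
have ba : b != a by rewrite -(inj_eq val_inj) /= neq_ltn ab orbT.
rewrite (bigD1 a) //= (bigD1 b) //= [ltRHS](bigD1 a) //= [in ltRHS](bigD1 b) //=.
rewrite !addrA !permM tpermL tpermR.
have -> : \sum_(i < n | (i != a) && (i != b)) d i * d ((tperm a b * s)%g i) =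
   \sum_(i < n | (i != a) && (i != b)) d i * d (s i).
  by apply: eq_bigr => i /andP[ia ib]; rewrite permM tpermD // eq_sym.
rewrite ltrD2r; have := d_incr ab; have := d_incr sab => h1 h2.
have := mulr_gt0 (_ : 0 < d (s b) - d (s a)) (_ : 0 < d b - d a).
rewrite !subr_gt0 => /(_ h1 h2); rewrite -subr_gt0 => H.
rewrite -subr_gt0; move: H; congr (_ < _); ring.
Qed.

(** The sum of the squares of [d a - d (s a)] is twice the gap between the two values, because [s]
    only permutes the squares of the [d a]. *)
Lemma perm_value_lt1 (s : 'S_n) : s != 1%g -> perm_value s < perm_value 1%g.
Proof.
move=> s1; have [a sa] : exists a, s a != a.
  apply: contrapT => H; case/eqP: s1; apply/permP => a; rewrite perm1.
  by apply/eqP/negPn/negP => sa; apply: H; exists a.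
have E : \sum_a d (s a) ^+ 2 = \sum_a d a ^+ 2.
  by rewrite [RHS](reindex_inj (@perm_inj _ s)).
have pos : 0 < \sum_a (d a - d (s a)) ^+ 2.
  rewrite (bigD1 a) //= ltr_pwDl //; last by rewrite sumr_ge0 // => b _; rewrite sqr_ge0.
  rewrite lt_neqAle sqr_ge0 andbT eq_sym sqrf_eq0 subr_eq0; apply: contra_neq sa => E'.
  apply/val_inj; move: E'; case: (ltngtP (s a) a) => // /d_incr; by [move=> /[swap] ->; rewrite ltxx].
have E2 : \sum_a (d a - d (s a)) ^+ 2 = 2 * (perm_value 1%g - perm_value s).
  have -> : \sum_a (d a - d (s a)) ^+ 2 =
     \sum_a d a ^+ 2 + \sum_a d (s a) ^+ 2 - 2 * perm_value s.
    rewrite /perm_value mulr_sumr -big_split -sumrB; apply: eq_bigr => b _ /=; ring.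
  rewrite E /perm_value; under [X in _ = 2 * (X - _)]eq_bigr do rewrite perm1 -expr2.
  by ring.
by move: pos; rewrite E2 pmulr_rgt0 // subr_gt0.
Qed.

(* Dual certificate of the assignment problem min_s sum_a d_a d_(s a): [u]
   integrates the slopes [d (rev k)] along the increasing sequence [d]. *)
Lemma assignment_potential : exists u v : 'I_n -> R,
  (forall a b, u a + v b <= d a * d b) /\
  (forall a, u a + v (rev_ord a) = d a * d (rev_ord a)).
Proof.
case: n d d_le => [|n'] e e_le.
  by exists (fun _ => 0), (fun _ => 0); split=> [] [].
pose D (k : nat) := e (inord k); pose W k := e (rev_ord (inord k)).
pose S x y := \sum_(x <= k < y) (D k.+1 - D k) * W k.
pose u (a : 'I_n'.+1) := S 0 a.
have D_le x y : (x <= y)%N -> (y < n'.+1)%N -> D x <= D y.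
  by move=> xy yn; apply: e_le; rewrite !inordK // (leq_ltn_trans xy).
have W_ge x y : (x <= y)%N -> (y < n'.+1)%N -> W y <= W x.
  move=> xy yn; apply: e_le; rewrite /= !inordK ?(leq_ltn_trans xy) //; lia.
(* Concavity of [u] as a function of [d]: its slopes [W] decrease, so the graph lies below the line
   of slope [W c] through the point of index [c], on either side of it. *)
have u_le (a c : 'I_n'.+1) : u a - u c <= (e a - e c) * e (rev_ord c).
  have eD (i : 'I_n'.+1) : e i = D i by rewrite /D inord_val.
  have eW : e (rev_ord c) = W c by rewrite /W inord_val.
  have an := ltn_ord a; have cn := ltn_ord c.
  rewrite eW !eD /u; have [ca|ac] := leqP c a.
    have SE : S 0 a = S 0 c + S c a by rewrite /S -big_cat_nat.
    have -> : S 0 a - S 0 c = S c a by rewrite SE addrC addKr.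
    rewrite -(telescope_sumr D ca) mulr_suml; apply: ler_sum_nat => k /andP[ck ka].
    apply: ler_wpM2l; first by rewrite subr_ge0; apply: D_le => //; lia.
    by apply: W_ge => //; lia.
  have -> : S 0 a - S 0 c = - S a c.
    have SE : S 0 c = S 0 a + S a c by rewrite /S -big_cat_nat // ltnW.
    by rewrite SE opprD addrA subrr add0r.
  rewrite -opprB mulNr lerN2 -(telescope_sumr D (ltnW ac)) mulr_suml.
  apply: ler_sum_nat => k /andP[ak kc].
  apply: ler_wpM2l; first by rewrite subr_ge0; apply: D_le => //; lia.
  by apply: W_ge => //; lia.
(* The second potential is forced by equality on the reversed pairs; the inequality is then the
   concavity bound at [c = rev_ord b]. *)
exists u, (fun b => e (rev_ord b) * e b - u (rev_ord b)); split=> [a b|a].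
  have := u_le a (rev_ord b); rewrite rev_ordK mulrBl.
  by lra.
by rewrite rev_ordK; lra.
Qed.

End Rearrangement.

(** * Critical points *)

Lemma rev_perm_neq1 {n0} : (2 <= n0.+1)%N -> (rev_perm : 'S_n0.+1) != 1%g.
Proof.
by move=> n2; apply/eqP => /permP /(_ ord0); rewrite permE perm1 => /(congr1 val) /=; lia.
Qed.

Section CriticalPoints.
Context {R : realType} {n0 m : nat}.
Local Notation C := R[i].
Local Notation n := n0.+1.
Local Notation Re := (@complex.Re R).
Variables (rho_d Z0 : 'M[C]_n) (d : 'I_n -> R).
Hypothesis UZ0 : Z0 *m Z0^t* = 1%:M.
Hypothesis rho_dE : rho_d = spec_mx Z0 d.
Hypothesis d_incr : forall i j : 'I_n, (i < j)%N -> d i < d j.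
Hypothesis d_ge0 : forall i, 0 <= d i.
Hypothesis d_sum : \sum_i d i = 1.
Hypothesis n2 : (2 <= n)%N.
Hypothesis mE : m = (n ^ 2 - n)%N.
Local Notation M := (isospectral_manifold rho_d).
Local Notation J := (overlap rho_d).

Let UZ0' : Z0^t* *m Z0 = 1%:M. Proof. exact: mulmx1C. Qed.

Let d_inj : injective d.
Proof.
move=> a b E; apply/val_inj; case: (ltngtP a b) => // /d_incr; by rewrite E ltxx.
Qed.

Let rho_d_diag : Z0^t* *m rho_d *m Z0 = real_diag d.
Proof. by rewrite rho_dE /spec_mx !mulmxA UZ0' mul1mx -mulmxA UZ0' mulmx1. Qed.

Definition crit_mx (s : 'S_n) : 'M[C]_n := spec_mx Z0 (d \o s).

Lemma crit_mx_isospectral s : M (crit_mx s).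
Proof. exact: (spec_isospectral UZ0 rho_dE d_ge0 d_sum). Qed.

Lemma crit_mx_inj : injective crit_mx.
Proof.
move=> s t /(congr1 (fun X => Z0^t* *m X *m Z0)).
rewrite /crit_mx /spec_mx !mulmxA UZ0' !mul1mx -!mulmxA UZ0' !mulmx1 => E.
apply/permP => a; apply: d_inj; apply: (@complexI R).
by have := congr1 (fun X : 'M[C]_n => X a a) E; rewrite !real_diagE eqxx !mulr1n.
Qed.

Lemma overlap_crit_mx s : J (crit_mx s) = perm_value d s.
Proof.
rewrite /overlap rho_dE /crit_mx /spec_mx !mulmxA -[_ *m Z0^t* *m Z0]mulmxA UZ0' mulmx1.
rewrite mxtrace_mulC !mulmxA UZ0' mul1mx Re_sum; apply: eq_bigr => a _.
by rewrite mul_diag_mx !mxE eqxx mulr1n cReM /= mulr0 subr0 mulrC.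
Qed.

Lemma isospectral_in_local_coordinates p (Q : ('rV[R]_m -> 'M[C]_n) -> Prop) :
  M p -> (forall phi, local_parametrization M p phi -> Q phi) ->
  in_local_coordinates M p Q.
Proof.
by move=> Mp HQ; split=> //; exact: (isospectral_chart UZ0 rho_dE d_inj d_ge0 d_sum n2 mE Mp).
Qed.

Lemma overlap_smooth : smooth_function M m J.
Proof.
move=> p Mp; apply: isospectral_in_local_coordinates => // phi.
move=> /local_parametrization_data [U [[oU U0] _ Sphi _ _]]; exists U; split=> //.
have alg := smooth_fun_algebra oU.
have Sm : mx_in (@smooth_on R m R U) (fun x => phi x *m rho_d).
  by apply: (mx_in_mul alg) => //; exact: (mx_in_cst alg).
by have [] := cplx_in_sum alg (index_enum _) (fun a => Sm a a).
Qed.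

Lemma critical_pointP p : critical_point M m J p <-> exists s, p = crit_mx s.
Proof.
have [pr [idx [pr_neq prK idxK]]] := offdiag_index n2 mE.
split=> [[[phi lphi] /(_ phi lphi) cphi]|[s ->]]; last first.
  apply: isospectral_in_local_coordinates; first exact: crit_mx_isospectral.
  move=> phi /local_parametrization_data [U [[oU U0] phi0 Sphi Mphi imm]].
  apply/(partial_overlap_eq0P pr_neq prK idxK UZ0 rho_dE d_inj UZ0 oU U0 phi0 Sphi Mphi imm).
  by move=> a b ab; rewrite rho_d_diag real_diagE (negPf ab).
have [U [[oU U0] phi0 Sphi Mphi imm]] := local_parametrization_data lphi.
(* Membership in M is not part of [critical_point]; it follows from the existence of a chart centred
   at [p]. *)
have Mp : M p by rewrite -phi0; exact: Mphi.
have [Z [t [UZ pE]]] := isospectral_spec UZ0 rho_dE Mp.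
have UZ' := mulmx1C UZ.
rewrite pE in phi0.
have D0 := (partial_overlap_eq0P pr_neq prK idxK UZ0 rho_dE d_inj UZ oU U0 phi0 Sphi Mphi imm).1 cphi.
(* Both matrices are diagonal in the basis [Z], so they commute; since [rho_d] has simple spectrum,
   [p] must then be diagonal in the fixed basis [Z0] as well. *)
have comm : p *m rho_d = rho_d *m p.
  have rE : rho_d = Z *m (Z^t* *m rho_d *m Z) *m Z^t*.
    by rewrite !mulmxA UZ mul1mx -mulmxA UZ mulmx1.
  rewrite rE pE /spec_mx; move: (Z^t* *m rho_d *m Z) D0 => D D0.
  rewrite !(mul_conj UZ); congr (_ *m _ *m _); apply/matrixP => a b.
  rewrite mul_diag_mx mul_mx_diag !mxE; have [->|ab] := eqVneq a b; first by rewrite mulrC.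
  by rewrite D0 // mulr0 mul0r.
pose Q := Z0^t* *m p *m Z0.
have pQ : p = Z0 *m Q *m Z0^t* by rewrite /Q !mulmxA UZ0 mul1mx -mulmxA UZ0 mulmx1.
have hQ : Q^t* = Q by rewrite /Q !adjmxM adjmxK pE spec_mx_adj mulmxA.
have Qcomm : Q *m real_diag d = real_diag d *m Q.
  by move: comm; rewrite pQ rho_dE /spec_mx !(mul_conj UZ0) => /(conj_mx_inj UZ0).
have Qoff a b : a != b -> Q a b = 0.
  move=> ab; have := congr1 (fun X : 'M[C]_n => X a b) Qcomm.
  rewrite mul_diag_mx mul_mx_diag !mxE mulrC => /eqP; rewrite -subr_eq0 -mulrBl mulf_eq0.
  by rewrite subr_eq0 => /orP[/eqP/complexI/d_inj E|/eqP //]; rewrite E eqxx in ab.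
have Qe : Q = real_diag (fun a => Re (Q a a)).
  apply/matrixP => a b; rewrite real_diagE; have [<-|ab] := eqVneq a b; last exact: Qoff.
  rewrite mulr1n; apply: complex_eqP => //=.
  have := (herm_part hQ a a).2; move: (complex.Im _) => x; lra.
(* The diagonal of [Q] has the spectrum of [rho_d], hence is a rearrangement of [d]; this yields the
   permutation. *)
have cQ : char_poly Q = char_poly rho_d.
  by have [_ <-] := Mp; exact: char_poly_conj UZ0'.
rewrite Qe rho_dE char_poly_real_diag char_poly_spec // in cQ.
have [s es] := prod_XsubC_perm cQ.
exists s; rewrite pQ Qe /crit_mx /spec_mx; congr (_ *m _ *m _); congr real_diag.
by apply/funext => a; have /complexI := es a.
Qed.

(** At [crit_mx s] the eigenbasis can be taken to be [Z0], in which [rho_d] is diagonal as the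
    Hessian formula requires. That [pr] reaches every off-diagonal pair lets a saddle be detected at
    a chosen pair. *)
Lemma hessian_crit s (phi : 'rV[R]_m -> 'M[C]_n) :
  local_parametrization M (crit_mx s) phi ->
  exists (N : 'M[R]_m) (pr : 'I_m -> 'I_n * 'I_n),
   [/\ N \in unitmx, forall j, (pr j).1 != (pr j).2,
       forall p, p.1 != p.2 -> exists k, pr k = p &
       hessian (J \o phi) 0 = - (N *m diag_mx (\row_k
         (2 * quotient_coef d s (pr k).1 (pr k).2)) *m N^T)].
Proof.
have [pr [idx [pr_neq prK idxK]]] := offdiag_index n2 mE.
move=> /local_parametrization_data [U [[oU U0] phi0 Sphi Mphi imm]].
exists (tangent_coords pr Z0 phi), pr; split=> //.
- exact: (tangent_coords_unit idxK UZ0 rho_dE d_inj UZ0 oU U0 phi0 Sphi Mphi imm).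
- by move=> p p12; exists (idx p); exact: idxK.
- exact: (hessian_overlap pr_neq prK idxK UZ0 rho_dE d_inj UZ0 oU U0 phi0 Sphi Mphi rho_d_diag).
Qed.

Lemma hyperbolic_crit s : hyperbolic M m J (crit_mx s).
Proof.
split; first by apply/critical_pointP; exists s.
apply: isospectral_in_local_coordinates; first exact: crit_mx_isospectral.
move=> phi /hessian_crit [N [pr [Nu pr_neq _ ->]]].
apply: congruent_diag_unit => // k; rewrite mxE mulf_neq0 ?pnatr_eq0 //.
rewrite mulf_neq0 ?invr_neq0 // subr_eq0; apply: contra_neq (pr_neq k).
  by move/d_inj.
by move/d_inj/perm_inj.
Qed.

Lemma saddle_crit s : s != 1%g -> s != rev_perm -> saddle M m J (crit_mx s).
Proof.
move=> s1 sr; split; first by apply/critical_pointP; exists s.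
apply: isospectral_in_local_coordinates; first exact: crit_mx_isospectral.
move=> phi /hessian_crit [N [pr [Nu pr_neq prk ->]]].
(* At an inversion the quotient is negative and, through the sign in front of the Hessian, gives a
   positive eigenvalue; a pair kept in order gives a negative one. *)
have [a [b [ab sba]]] := inversion_of_perm s1.
have [a' [b' [ab' sab']]] := noninversion_of_perm sr.
have nab (x y : 'I_n) : (x < y)%N -> x != y by move=> xy; rewrite -(inj_eq val_inj) /= neq_ltn xy.
have [k kE] := prk (a, b) (nab _ _ ab); have [k' kE'] := prk (a', b') (nab _ _ ab').
split.
- apply: (congruent_diag_pos Nu (k := k)); rewrite mxE kE /quotient_coef /=.
  rewrite pmulr_rlt0 // nmulr_rlt0 ?subr_lt0 ?d_incr //.
  by rewrite invr_gt0 subr_gt0 d_incr.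
- apply: (congruent_diag_neg Nu (k := k')); rewrite mxE kE' /quotient_coef /=.
  rewrite pmulr_rgt0 // nmulr_rgt0 ?subr_lt0 ?d_incr //.
  by rewrite invr_lt0 subr_lt0 d_incr.
Qed.

Lemma crit_mx1 : crit_mx 1%g = rho_d.
Proof.
by rewrite rho_dE /crit_mx; congr spec_mx; apply/funext => a; rewrite /= perm1.
Qed.

Lemma overlap_le rho : M rho -> J rho <= perm_value d 1%g.
Proof.
move=> Mr; have hr : rho^t* = rho by have [[/herm_adjmxP ? _ _] _] := Mr.
have Md : M rho_d by have := crit_mx_isospectral 1%g; rewrite crit_mx1.
have t2 p : M p -> Re (\tr (p *m p)) = perm_value d 1%g.
  move=> Mp; have := trace_power_isospectral UZ0 rho_dE 2 Mp.
  rewrite expr2 => ->; rewrite Re_sum; apply: eq_bigr => a _.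
  by rewrite expr2 cReM /= mulr0 subr0 perm1.
have : 0 <= Re (\tr ((rho - rho_d)^t* *m (rho - rho_d))).
  rewrite Re_sum sumr_ge0 // => a _; rewrite mxE Re_sum sumr_ge0 // => b _.
  by rewrite adjE cReM cRe_conj cIm_conj mulNr opprK -!expr2 addr_ge0 ?sqr_ge0.
have hd : rho_d^t* = rho_d by rewrite rho_dE spec_mx_adj.
have RB (A B : 'M[C]_n) : Re (\tr (A - B)) = Re (\tr A) - Re (\tr B).
  by rewrite linearB /= cReD cReN.
rewrite adjmxB hr hd mulmxBl !mulmxBr !RB.
rewrite !t2 // [\tr (rho_d *m rho)]mxtrace_mulC -/(overlap rho_d rho); lra.
Qed.

(** Weak duality: the inequality u_a + v_(s b) <= d_a d_(s b) is averaged with the weights |V_ab|^2.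
    Their rows and columns sum to 1 by unitarity of [V], so the average is the sum of all
    potentials, the value at the reversal. Birkhoff's theorem on bistochastic matrices is
    bypassed. *)
Lemma overlap_ge rho : M rho -> perm_value d rev_perm <= J rho.
Proof.
move=> /(isospectral_spec UZ0 rho_dE) [Z [s [UZ ->]]].
have [u [v [uv uve]]] := assignment_potential d_incr.
pose V := Z0^t* *m Z.
have UV : V *m V^t* = 1%:M.
  by rewrite /V adjmxM adjmxK mulmxA -[Z0^t* *m Z *m _]mulmxA UZ mulmx1.
have UV' := mulmx1C UV.
pose q a b := Re (V a b) ^+ 2 + complex.Im (V a b) ^+ 2.
have q0 a b : 0 <= q a b by rewrite addr_ge0 ?sqr_ge0.
have qr a : \sum_b q a b = 1.
  have := congr1 (fun X : 'M[C]_n => Re (X a a)) UV; rewrite !mxE eqxx /= Re_sum => <-.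
  apply: eq_bigr => b _; rewrite adjE cReM cRe_conj cIm_conj mulrN opprK -!expr2 //.
have qc b : \sum_a q a b = 1.
  have := congr1 (fun X : 'M[C]_n => Re (X b b)) UV'; rewrite !mxE eqxx /= Re_sum => <-.
  apply: eq_bigr => a _; rewrite adjE cReM cRe_conj cIm_conj mulNr opprK -!expr2 //.
have -> : J (spec_mx Z (d \o s)) = \sum_a \sum_b d a * d (s b) * q a b.
  have -> : J (spec_mx Z (d \o s)) = Re (\tr (real_diag d *m spec_mx V (d \o s))).
    rewrite /overlap rho_dE /spec_mx /V adjmxM adjmxK; congr Re.
    by rewrite mxtrace_mulC -!mulmxA mxtrace_mulC !mulmxA.
  rewrite Re_sum; apply: eq_bigr => a _; rewrite mul_diag_mx mxE [X in X * _]mxE spec_mxE.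
  rewrite mulr_sumr Re_sum; apply: eq_bigr => b _.
  by rewrite !(cReM, cImM) cRe_conj cIm_conj /= /q; ring.
apply: (@le_trans _ _ (\sum_a \sum_b (u a + v (s b)) * q a b)); last first.
  by apply: ler_sum => a _; apply: ler_sum => b _; rewrite ler_wpM2r.
have -> : \sum_a \sum_b (u a + v (s b)) * q a b = \sum_a u a + \sum_b v b.
  under eq_bigr do under eq_bigr do rewrite mulrDl.
  under eq_bigr do rewrite big_split; rewrite big_split /=; congr (_ + _).
    by apply: eq_bigr => a _; rewrite -mulr_sumr qr mulr1.
  rewrite exchange_big /= [RHS](reindex_inj (@perm_inj _ s)); apply: eq_bigr => b _.
  by rewrite -mulr_sumr qc mulr1.
rewrite [X in _ + X](reindex_inj rev_ord_inj) -big_split /= /perm_value.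
by apply: ler_sum => a _; rewrite permE uve.
Qed.

(** At the lower end, swapping a pair that [s] keeps in order gives another critical matrix of
    strictly smaller value, and that value is still bounded below by the global minimum. *)
Lemma overlap_crit_strict s : s != 1%g -> s != rev_perm ->
  J (crit_mx rev_perm) < J (crit_mx s) < J (crit_mx 1%g).
Proof.
move=> s1 sr; rewrite !overlap_crit_mx (perm_value_lt1 d_incr s1) andbT.
have [a [b [ab sab]]] := noninversion_of_perm sr.
apply: le_lt_trans (perm_value_swap d_incr ab sab).
by rewrite -(overlap_crit_mx (tperm a b * s)%g); apply: overlap_ge; exact: crit_mx_isospectral.
Qed.

Lemma critical_set : [set p | critical_point M m J p] = crit_mx @` [set: 'S_n].
Proof.
by apply/seteqP; split=> [p /critical_pointP [s ->]|p [s _ <-]];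
  [exists s | apply/critical_pointP; exists s].
Qed.

Lemma card_critical_set : [set p | critical_point M m J p] #= `I_(n`!).
Proof.
rewrite critical_set; apply: (card_eq_trans (inj_card_eq (in2W crit_mx_inj))).
have -> : [set: 'S_n] = [set s | s \in [set: 'S_n]%SET].
  by apply/seteqP; split=> s //= _; rewrite inE.
by rewrite -card_Sn -cardsT; exact: card_eq_finset.
Qed.

Lemma card_other_critical :
  [set p | critical_point M m J p] `\` [set crit_mx 1%g; crit_mx rev_perm] #= `I_(n`! - 2).
Proof.
have -> : [set p | critical_point M m J p] `\` [set crit_mx 1%g; crit_mx rev_perm] =
    crit_mx @` [set s | s \in (~: [set 1%g; rev_perm])%SET].
  rewrite critical_set; apply/seteqP; split=> [p [[s _ <-] /= H]|p /= [s]].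
    exists s; last by []; rewrite /= finset.in_setC finset.in_set2; apply/norP; split; apply/eqP => E; apply: H; rewrite E;
      by [left | right].
  rewrite finset.in_setC finset.in_set2 => /norP[s1 sr] <-; split; first by exists s.
  by move=> [/crit_mx_inj E|/crit_mx_inj E]; [move: s1 | move: sr]; rewrite E eqxx.
apply: (card_eq_trans (inj_card_eq (in2W crit_mx_inj))).
suff <- : #|(~: [set 1%g; rev_perm : 'S_n])%SET| = (n`! - 2)%N by exact: card_eq_finset.
by rewrite cardsCs finset.setCK cards2 eq_sym rev_perm_neq1 // card_Sn.
Qed.

End CriticalPoints.

Theorem mainTheorem6 (R : realType) (n : nat) (hn : (2 <= n)%N)
    (rho_d : 'M[R[i]]_n)
    (hrho_d : density_operator rho_d) (hgen : generic rho_d) :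
  let M := isospectral_manifold rho_d in
  let m := (n ^ 2 - n)%N in
  let J := overlap rho_d in
  let crit := [set rho | critical_point M m J rho] in
  [/\ Morse_function M m J,
      crit #= `I_(n`!),
      (forall rho, crit rho -> hyperbolic M m J rho) &
      exists rho_max rho_min : 'M[R[i]]_n,
        [/\ crit rho_max, crit rho_min, rho_max <> rho_min,
            (forall rho, M rho -> J rho_min <= J rho <= J rho_max) &
            let others := crit `\` [set rho_max; rho_min] in
            others #= `I_(n`! - 2) /\
            forall rho, others rho ->
              saddle M m J rho /\ J rho_min < J rho < J rho_max]].
Proof.
have [Z0 [d [UZ0 rho_dE d_incr d_ge0 d_sum]]] := density_spec hrho_d hgen.
case: n hn rho_d hrho_d hgen Z0 d UZ0 rho_dE d_incr d_ge0 d_sum => // n0 n2 rho_d _ _.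
move=> Z0 d UZ0 rho_dE d_incr d_ge0 d_sum M m J crit.
have critP := critical_pointP UZ0 rho_dE d_incr d_ge0 d_sum n2 (erefl m).
have hyp rho : crit rho -> hyperbolic M m J rho.
  by move=> /critP [s ->]; exact: (hyperbolic_crit UZ0 rho_dE d_incr d_ge0 d_sum n2 (erefl m)).
split=> //.
- by split=> //; exact: (overlap_smooth UZ0 rho_dE d_incr d_ge0 d_sum n2 (erefl m)).
- exact: (card_critical_set UZ0 rho_dE d_incr d_ge0 d_sum n2 (erefl m)).
(* The maximum is attained at [rho_d] itself, by [crit_mx1]; the minimum pairs the eigenvalues in
   opposite order. *)
exists (crit_mx Z0 d 1%g), (crit_mx Z0 d rev_perm); split.
- by apply/critP; exists 1%g.
- by apply/critP; exists rev_perm.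
- by move=> E; have := rev_perm_neq1 n2; rewrite -(crit_mx_inj UZ0 d_incr E) eqxx.
- move=> rho Mrho; rewrite /J !(overlap_crit_mx UZ0 rho_dE).
  by rewrite (overlap_ge UZ0 rho_dE d_incr) // (overlap_le UZ0 rho_dE).
- split; first exact: (card_other_critical UZ0 rho_dE d_incr d_ge0 d_sum n2 (erefl m)).
  move=> rho [/critP [s ->] H].
  have s1 : s != 1%g by apply/eqP => E; apply: H; left; rewrite E.
  have sr : s != rev_perm by apply/eqP => E; apply: H; right; rewrite E.
  split; first exact: (saddle_crit UZ0 rho_dE d_incr d_ge0 d_sum n2 (erefl m)).
  exact: (overlap_crit_strict UZ0 rho_dE d_incr d_ge0 d_sum).
Qed.
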